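(* Let $T$ be an invertible Toeplitz-block Toeplitz matrix and let the corresponding matrix $g_{12}$ or $g_{21}$ (defined below) be given. Then \[ \omega(\lambda,\mu)=\mathrm{i}(\lambda_p-\mu_p)^{-1}u(\mu)P_p\widehat u(\lambda)\qquad (p=1,2), \] where $u$ and $\widehat u$ can be recovered from \[ \widehat u(\lambda)=-\mathrm{i}\left(\lambda_1-\tfrac{\mathrm{i}}{2}\right)^{-n}\left(\lambda_2-\tfrac{\mathrm{i}}{2}\right)^{-m}\theta(\lambda)G(\lambda)^{-1}\mathrm{col}\begin{bmatrix}0 & \mathbf{1}_m & 0 & \mathbf{1}_n\end{bmatrix}, \] \[ u(\mu)=\left(\frac{\mu_1-\frac{\mathrm{i}}{2}}{\mu_1+\frac{\mathrm{i}}{2}}\right)^n\left(\frac{\mu_2-\frac{\mathrm{i}}{2}}{\mu_2+\frac{\mathrm{i}}{2}}\right)^m\widehat u(\mu)^{\tau}\,\mathrm{diag}\{J_{2m}U_{2m},\,J_{2n}U_{2n}\}, \] with $G$ expressed via $g_{12}$ or, equivalently, via $g_{21}$ (using $g_{21}=-U_{2n}J_{2n}g_{12}^{\tau}J_{2m}U_{2m}$), and $\theta(\lambda)=\sqrt{\det G(\lambda)}$.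
   Context: Let $T=\{\mathcal{T}_{i-k}\}_{i,k=1}^n$, $\mathcal{T}_r=\{t_r^{(j-\ell)}\}_{j,\ell=1}^m$, be an invertible $mn\times mn$ Toeplitz-block Toeplitz matrix, $R=T^{-1}$. Let $a_r=0$ for $r<0$, $a_0=\mathrm{i}/2$, $a_r=\mathrm{i}$ for $r>0$; $\mathcal{A}_1=\{a_{j-\ell}\}_{j,\ell=1}^n$, $\mathcal{A}_2=\{a_{j-\ell}\}_{j,\ell=1}^m$; $A_1=\{a_{i-k}I_m\}_{i,k=1}^n$, $A_2=\mathrm{diag}\{\mathcal{A}_2,\ldots,\mathcal{A}_2\}$ ($n$ blocks). $\mathbf{1}_r$ is the column of $r$ ones, $\mathbf{1}=\mathbf{1}_{mn}$, $I=I_{mn}$, $^{\tau}$ is transpose. Define $\omega(\lambda,\mu)=\mathbf{1}^*(A_1^*-\mu_1 I)^{-1}(A_2^*-\mu_2 I)^{-1}T^{-1}(A_2-\lambda_2 I)^{-1}(A_1-\lambda_1 I)^{-1}\mathbf{1}$. Matrices: $M_{11}=\mathrm{col}[\mathcal{M}_{11}^{(1)},\ldots,\mathcal{M}_{11}^{(n)}]$, $\mathcal{M}_{11}^{(i)}=\frac12\mathcal{T}_0+\sum_{s=1}^{i-1}\mathcal{T}_s$; $M_{21}=[I_m\ \cdots\ I_m]$, $M_{31}=M_{21}^*$; $M_{41}=[\mathcal{M}_{41}^{(1)}\ \cdots\ \mathcal{M}_{41}^{(n)}]$, $\mathcal{M}_{41}^{(k)}=\frac12\mathcal{T}_0+\sum_{s=1}^{k-1}\mathcal{T}_{-s}$.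 $M_{12}=\{\mathcal{M}_{12}^{(i-k)}\}_{i,k=1}^n$ with $\mathcal{M}_{12}^{(r)}=\mathrm{col}[\frac12 t_r^{(0)},\ \frac12 t_r^{(0)}+t_r^{(1)},\ldots,\frac12 t_r^{(0)}+\sum_{j=2}^m t_r^{(j-1)}]$; $M_{22}=\{\mathcal{M}_{22}^{(i-k)}\}_{i,k=1}^n$ with $\mathcal{M}_{22}^{(0)}=\mathbf{1}_m^*$, $\mathcal{M}_{22}^{(r)}=0$ for $r\neq0$; $M_{32}=M_{22}^*$; $M_{42}=\{\mathcal{M}_{42}^{(i-k)}\}_{i,k=1}^n$ with $\mathcal{M}_{42}^{(r)}=[\frac12 t_r^{(0)},\ \frac12 t_r^{(0)}+t_r^{(-1)},\ldots,\frac12 t_r^{(0)}+\sum_{\ell=2}^m t_r^{(1-\ell)}]$. $K_{11}=\mathrm{col}[\frac12\mathcal{M}_{42}^{(0)},\ \frac12\mathcal{M}_{42}^{(0)}+\mathcal{M}_{42}^{(1)},\ldots,\frac12\mathcal{M}_{42}^{(0)}+\sum_{i=2}^n\mathcal{M}_{42}^{(i-1)}]$, $K_{12}=[\frac12\mathcal{M}_{12}^{(0)},\ \frac12\mathcal{M}_{12}^{(0)}+\mathcal{M}_{12}^{(-1)},\ldots,\frac12\mathcal{M}_{12}^{(0)}+\sum_{k=2}^n\mathcal{M}_{12}^{(1-k)}]$. $\Pi_p=[M_{1p}\ M_{3p}]$, $\widehat\Pi_p=\mathrm{col}[M_{2p}\ M_{4p}]$, $\Gamma_p=R\Pi_p$,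 $\widehat\Gamma_p=\widehat\Pi_pR$, $\Gamma=[\Gamma_1\ \Gamma_2]$, $\widehat\Gamma=\mathrm{col}[\widehat\Gamma_1\ \widehat\Gamma_2]$, $P_1=\mathrm{diag}\{I_{2m},0\}$, $P_2=I_{2(m+n)}-P_1$. $g_{12}=\mathrm{i}\widehat\Pi_1T^{-1}\Pi_2-\mathrm{i}\begin{bmatrix}\mathbf{1}_m\mathbf{1}_n^* & 0\\ K_{12} & 0\end{bmatrix}$, $g_{21}=\mathrm{i}\widehat\Pi_2T^{-1}\Pi_1-\mathrm{i}\begin{bmatrix}\mathbf{1}_n\mathbf{1}_m^* & 0\\ K_{11} & 0\end{bmatrix}$. $U_{2n}=\{\delta_{2n-i-k+1}\}_{i,k=1}^{2n}$, $J_{2n}=\mathrm{diag}\{I_n,-I_n\}$, and similarly $U_{2m}$, $J_{2m}$. $G(\lambda)=\begin{bmatrix}\mathrm{diag}\{\mathcal{A}_2-\lambda_2I_m,\ \mathcal{A}_2-\lambda_2I_m\} & g_{12}\\ g_{21} & \mathrm{diag}\{\mathcal{A}_1-\lambda_1I_n,\ \mathcal{A}_1-\lambda_1I_n\}\end{bmatrix}$, and $\theta(\lambda)=\sqrt{\det G(\lambda)}$ is the branch which is a polynomial whose coefficient of $\lambda_1^n\lambda_2^m$ equals $-1$ (such a polynomial exists). $u(\mu)=\mathbf{1}^*(A_1^*-\mu_1I)^{-1}(A_2^*-\mu_2I)^{-1}\Gamma-\mathrm{i}[\mathbf{1}_m^*(\mathcal{A}_2^*-\mu_2I_m)^{-1}\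 \ 0\ \ \mathbf{1}_n^*(\mathcal{A}_1^*-\mu_1I_n)^{-1}\ \ 0]$, $\widehat u(\lambda)=\widehat\Gamma(A_2-\lambda_2I)^{-1}(A_1-\lambda_1I)^{-1}\mathbf{1}+\mathrm{i}\,\mathrm{col}[0\ \ (\mathcal{A}_2-\lambda_2I_m)^{-1}\mathbf{1}_m\ \ 0\ \ (\mathcal{A}_1-\lambda_1I_n)^{-1}\mathbf{1}_n]$. *)

(* Defs.v *)
From HB Require Import structures.
From mathcomp Require Import all_boot all_order all_algebra.
From mathcomp Require Import reals.
From mathcomp Require Export complex.
Set Implicit Arguments. Unset Strict Implicit. Unset Printing Implicit Defensive.
Import Order.TTheory GRing.Theory Num.Theory.
Local Open Scope ring_scope.

Section TBT.
Variable R : realType.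
Local Notation C := (R[i]).
Variables (n m : nat).
Variable t : int -> int -> C.

Definition iC : C := Complex 0 1.
Definition halfC : C := 2%:R^-1.

(* global index I of an mn-vector <-> (block index I %/ m, inner index I %% m),
   0-based; so index ((i-1) m + (j-1)) <-> (i,j) in the paper. *)
Definition blk (I : 'I_(n * m)) : nat := (I %/ m)%N.
Definition inn (I : 'I_(n * m)) : nat := (I %% m)%N.
Definition zd (a b : nat) : int := (a%:Z - b%:Z)%R.

Definition TBT : 'M[C]_(n * m) :=
  \matrix_(I, K) t (zd (blk I) (blk K)) (zd (inn I) (inn K)).

Definition adjmx (p q : nat) (A : 'M[C]_(p, q)) : 'M[C]_(q, p) :=
  map_mx (@conjc R) A^T.

Definition aa (r : int) : C := if (r < 0)%R then 0 else if r == 0 then halfC * iC else iC.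

Definition A1s : 'M[C]_n := \matrix_(j, l) aa (zd j l).
Definition A2s : 'M[C]_m := \matrix_(j, l) aa (zd j l).
Definition A1 : 'M[C]_(n * m) :=
  \matrix_(I, K) (if inn I == inn K then aa (zd (blk I) (blk K)) else 0).
Definition A2 : 'M[C]_(n * m) :=
  \matrix_(I, K) (if blk I == blk K then aa (zd (inn I) (inn K)) else 0).

Definition ones (p q : nat) : 'M[C]_(p, q) := const_mx 1.

Definition omega (l1 l2 mu1 mu2 : C) : C :=
  (ones 1 (n * m) *m invmx (adjmx A1 - mu1%:M) *m invmx (adjmx A2 - mu2%:M)
     *m invmx TBT *m invmx (A2 - l2%:M) *m invmx (A1 - l1%:M) *m ones (n * m) 1)
  ord0 ord0.

Definition M11 : 'M[C]_(n * m, m) := \matrix_(I, l)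
  (halfC * t 0 (zd (inn I) l) + \sum_(1 <= s < (blk I).+1) t s%:Z (zd (inn I) l)).
Definition M21 : 'M[C]_(m, n * m) := \matrix_(j, K) (if j == inn K :> nat then 1 else 0).
Definition M31 : 'M[C]_(n * m, m) := adjmx M21.
Definition M41 : 'M[C]_(m, n * m) := \matrix_(j, K)
  (halfC * t 0 (zd j (inn K)) + \sum_(1 <= s < (blk K).+1) t (- s%:Z) (zd j (inn K))).
Definition cM12 (r : int) (j : nat) : C :=
  halfC * t r 0 + \sum_(1 <= s < j.+1) t r s%:Z.
Definition cM42 (r : int) (l : nat) : C :=
  halfC * t r 0 + \sum_(1 <= s < l.+1) t r (- s%:Z).
Definition M12 : 'M[C]_(n * m, n) := \matrix_(I, k) cM12 (zd (blk I) k) (inn I).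
Definition M22 : 'M[C]_(n, n * m) := \matrix_(i, K) (if i == blk K :> nat then 1 else 0).
Definition M32 : 'M[C]_(n * m, n) := adjmx M22.
Definition M42 : 'M[C]_(n, n * m) := \matrix_(i, K) cM42 (zd i (blk K)) (inn K).
Definition K11 : 'M[C]_(n, m) := \matrix_(i, l)
  (halfC * cM42 0 l + \sum_(1 <= s < i.+1) cM42 s%:Z l).
Definition K12 : 'M[C]_(m, n) := \matrix_(j, k)
  (halfC * cM12 0 j + \sum_(1 <= s < k.+1) cM12 (- s%:Z) j).

Definition Pi1 : 'M[C]_(n * m, m + m) := row_mx M11 M31.
Definition Pi2 : 'M[C]_(n * m, n + n) := row_mx M12 M32.
Definition hPi1 : 'M[C]_(m + m, n * m) := col_mx M21 M41.
Definition hPi2 : 'M[C]_(n + n, n * m) := col_mx M22 M42.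
Definition RR : 'M[C]_(n * m) := invmx TBT.
Definition Gam1 := RR *m Pi1.
Definition Gam2 := RR *m Pi2.
Definition hGam1 := hPi1 *m RR.
Definition hGam2 := hPi2 *m RR.
Definition Gam : 'M[C]_(n * m, (m + m) + (n + n)) := row_mx Gam1 Gam2.
Definition hGam : 'M[C]_((m + m) + (n + n), n * m) := col_mx hGam1 hGam2.
Definition P1 : 'M[C]_((m + m) + (n + n)) := block_mx 1%:M 0 0 0.
Definition P2 : 'M[C]_((m + m) + (n + n)) := 1%:M - P1.

Definition g12 : 'M[C]_(m + m, n + n) :=
  iC *: (hPi1 *m invmx TBT *m Pi2) - iC *: block_mx (ones m n) 0 K12 0.
Definition g21 : 'M[C]_(n + n, m + m) :=
  iC *: (hPi2 *m invmx TBT *m Pi1) - iC *: block_mx (ones n m) 0 K11 0.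

Definition Umx (p : nat) : 'M[C]_(p + p) :=
  \matrix_(i, k) (if (i + k)%N == (p + p).-1 then 1 else 0).
Definition Jmx (p : nat) : 'M[C]_(p + p) := block_mx 1%:M 0 0 (- 1%:M).

Definition Gmx (l1 l2 : C) : 'M[C]_((m + m) + (n + n)) :=
  block_mx (block_mx (A2s - l2%:M) 0 0 (A2s - l2%:M)) g12
           g21 (block_mx (A1s - l1%:M) 0 0 (A1s - l1%:M)).

Definition u (mu1 mu2 : C) : 'M[C]_(1, (m + m) + (n + n)) :=
  ones 1 (n * m) *m invmx (adjmx A1 - mu1%:M) *m invmx (adjmx A2 - mu2%:M) *m Gam
  - iC *: row_mx (row_mx (ones 1 m *m invmx (adjmx A2s - mu2%:M)) 0)
                 (row_mx (ones 1 n *m invmx (adjmx A1s - mu1%:M)) 0).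

Definition hu (l1 l2 : C) : 'M[C]_((m + m) + (n + n), 1) :=
  hGam *m invmx (A2 - l2%:M) *m invmx (A1 - l1%:M) *m ones (n * m) 1
  + iC *: col_mx (col_mx 0 (invmx (A2s - l2%:M) *m ones m 1))
                 (col_mx 0 (invmx (A1s - l1%:M) *m ones n 1)).

(* evaluation of a bivariate polynomial: inner variable lambda_1, outer lambda_2;
   the coefficient of lambda_1^a lambda_2^b of th is (th`_b)`_a *)
Definition eval2 (th : {poly {poly C}}) (l1 l2 : C) : C := (th.[l2%:P]).[l1].

Definition theta_branch (th : {poly {poly C}}) : Prop :=
  (forall l1 l2, eval2 th l1 l2 ^+ 2 = \det (Gmx l1 l2)) /\ (th`_m)`_n = -1.

Definition ecol : 'M[C]_((m + m) + (n + n), 1) :=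
  col_mx (col_mx 0 (ones m 1)) (col_mx 0 (ones n 1)).

End TBT.

(* Main.v *)
Require Import Defs.
From HB Require Import structures.
From mathcomp Require Import all_boot all_order all_algebra.
From mathcomp Require Import reals complex.
From mathcomp Require Import mxtens ring zify.
Import Order.TTheory GRing.Theory Num.Theory.
Local Open Scope ring_scope.

(** Write b for the vector of ones and R for the inverse of T.  Each displacement equation
    A_p T - T A_p^* = i Pi_p hPi_p, multiplied by R on both sides and sandwiched between the
    resolvents, gives one formula for omega; the reflection U T^T U = T (U reversing the order of
    the basis) relates u to hu and g21 to g12.

    Replacing the half-sums of Toeplitz coefficients that start at one end by minus those that
    start at the other end turns A_p^* into A_p in all displacement equations.  In this form one
    reads off G hu = i f ecol with f = 1 + r R Y b, where Y = (A_1 - l1)^-1 (A_2 - l2)^-1 and r is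
    the row of double half-sums of T.  On the other hand Sylvester's identity turns det G into a
    determinant of size 2mn built on T (+) T, which a block column and a block row operation reduce
    to the two rank one perturbations T + Y b r and T + U r^T b^T Y of T.  By reflection both have
    determinant f det T.  So det G = (l1 - i/2)^2n (l2 - i/2)^2m f^2, and theta is
    - (l1 - i/2)^n (l2 - i/2)^m f, a polynomial because Y b is explicit. *)

Set Implicit Arguments. Unset Strict Implicit. Unset Printing Implicit Defensive.

Arguments mxtens_index {m n}.
Arguments mxtens_unindex {m n}.

(** * Determinant of the matrix of a displacement structure *)

(** With [mx_ring] it settles linear matrix identities by comparing entries; matrix products are
    treated as atoms. *)
Lemma mx_linE (F : fieldType) p q (x : 'I_p) (y : 'I_q) :
  (((forall A B : 'M[F]_(p, q), ((A + B) x y = A x y + B x y)%R)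
  * (forall A : 'M[F]_(p, q), ((- A) x y = - A x y)%R))
  * ((forall k (A : 'M[F]_(p, q)), ((k *: A) x y = k * A x y)%R)
  * (((0 : 'M[F]_(p, q)) x y = 0)%R)))%type.
Proof. by split; split => *; rewrite mxE. Qed.

Ltac mx_ring := apply/matrixP => ? ?; rewrite !mx_linE; ring.

(** Sylvester's identity: one unipotent block matrix, multiplied on either side by a block
    triangular matrix, intertwines the two determinants. *)
Lemma det_1addmxC (F : fieldType) p q (X : 'M[F]_(p, q)) (Y : 'M[F]_(q, p)) :
  \det (1%:M + X *m Y) = \det (1%:M + Y *m X).
Proof.
have e : block_mx 1%:M 0 Y 1%:M *m block_mx 1%:M (- X) 0 (1%:M + Y *m X)
       = block_mx (1%:M + X *m Y) (- X) 0 1%:M *m block_mx 1%:M 0 Y 1%:M.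
  rewrite !mulmx_block !(mul1mx, mulmx1, mul0mx, mulmx0) ?(add0r, addr0) mulNmx.
  by rewrite addrK mulmxN [1%:M + Y *m X]addrC addKr.
have := congr1 determinant e.
by rewrite !det_mulmx !det_ublock !det_lblock !det1 !mul1r !mulr1.
Qed.

Lemma det_schur (F : fieldType) p q (A : 'M[F]_p) B C (D : 'M[F]_q) :
  A \in unitmx ->
  \det (block_mx A B C D) = \det A * \det (D - C *m invmx A *m B).
Proof.
move=> uA.
have -> : block_mx A B C D =
  block_mx 1%:M 0 (C *m invmx A) 1%:M *m block_mx A B 0 (D - C *m invmx A *m B).
  rewrite mulmx_block !(mul1mx, mul0mx, mulmx0) ?(add0r, addr0).
  by rewrite mulmxKV // [C *m _ *m B + _]addrC subrK.
by rewrite det_mulmx det_lblock det_ublock !det1 !mul1r.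
Qed.

Lemma commmx_inv (F : fieldType) p q (A : 'M[F]_p) (B : 'M[F]_q) X :
  A \in unitmx -> B \in unitmx -> A *m X = X *m B ->
  invmx A *m X = X *m invmx B.
Proof.
by move=> uA uB e; rewrite -[X in _ *m X](mulmxK uB) -e !mulmxA mulVmx // mul1mx.
Qed.

Section Displacement.
(* [L1], ..., [L4] and [N1], ..., [N4] stand for the matrices [M_k1] and [M_k2] of the paper and
   [K1], [K2] for [K_11], [K_12], in complementary form; [a] and [c] are the small shifted matrices
   [A2s - l2] and [A1s - l1], [A1] and [A2] the shifted big ones. *)
Variables (F : fieldType) (N m n : nat) (i : F).
Variables (T A1 A2 : 'M[F]_N) (a : 'M[F]_m) (c : 'M[F]_n).
Variables (L2 L4 : 'M[F]_(m, N)) (L1 L3 : 'M[F]_(N, m)).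
Variables (N2 N4 : 'M[F]_(n, N)) (N1 N3 : 'M[F]_(N, n)).
Variables (K1 : 'M[F]_(n, m)) (K2 : 'M[F]_(m, n)).
Variables (em : 'cV[F]_m) (en : 'cV[F]_n) (b : 'cV[F]_N).
Variables (r : 'rV[F]_N) (s : 'cV[F]_N).
Hypotheses (ii : i * i = -1).
Hypotheses (uT : T \in unitmx) (uA1 : A1 \in unitmx) (uA2 : A2 \in unitmx).
Hypotheses (ua : a \in unitmx) (uc : c \in unitmx).
Hypothesis A12 : A1 *m A2 = A2 *m A1.
Hypotheses (A2L3 : A2 *m L3 = L3 *m a) (L2A2 : L2 *m A2 = a *m L2).
Hypotheses (A1N3 : A1 *m N3 = N3 *m c) (N2A1 : N2 *m A1 = c *m N2).
Hypothesis A1T : A1 *m T - T *m A1 = i *: (L1 *m L2 + L3 *m L4).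
Hypothesis A2T : A2 *m T - T *m A2 = i *: (N1 *m N2 + N3 *m N4).
Hypothesis aL4 : a *m L4 - L4 *m A2 = i *: (K2 *m N2 + em *m r).
Hypothesis cN4 : c *m N4 - N4 *m A1 = i *: (K1 *m L2 + en *m r).
Hypothesis A2L1 : A2 *m L1 - L1 *m a = i *: (N3 *m K1 + s *m em^T).
Hypotheses (L3em : L3 *m em = b) (N3en : N3 *m en = b) (emL2 : em^T *m L2 = b^T).

Let Y := invmx A1 *m invmx A2.

Definition disp12 := i *: (col_mx L2 L4 *m invmx T *m row_mx N1 N3 - block_mx 0 0 K2 0).
Definition disp21 := i *: (col_mx N2 N4 *m invmx T *m row_mx L1 L3 - block_mx 0 0 K1 0).
Definition dispG := block_mx (block_mx a 0 0 a) disp12 disp21 (block_mx c 0 0 c).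

(** The blocks of T (+) T perturbed by the off-diagonal data, to which Sylvester's identity reduces
    [dispG]; see [EDB] in the proof of [det_dispG]. *)
Let schur11 := T - N3 *m invmx c *m K1 *m invmx a *m L2.
Let schur12 := i *: (N1 *m invmx c *m N2 + N3 *m invmx c *m N4).
Let schur21 := i *: (L1 *m invmx a *m L2 + L3 *m invmx a *m L4).
Let schur22 := T - L3 *m invmx a *m K2 *m invmx c *m N2.

(** The equation [cN4] moves [A1] past the inverse of [c]. The terms in [K1] then cancel, the
    displacement equation [A2T] leaves [A2 *m T], and only the rank one term in [r] survives. *)
Lemma schur_col1 : schur11 *m A2 + schur12 *m A1 = A2 *m T + invmx A1 *m b *m r.
Proof.
have e1 : schur11 *m A2 = T *m A2 - N3 *m invmx c *m K1 *m L2.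
  by rewrite /schur11 mulmxBl -!mulmxA L2A2 mulKmx.
have e2 : schur12 *m A1 = i *: (N1 *m N2 + N3 *m N4)
    + (N3 *m invmx c *m K1 *m L2 + N3 *m invmx c *m en *m r).
  rewrite /schur12 -scalemxAl mulmxDl -!mulmxA N2A1 mulKmx //.
  have -> : N4 *m A1 = c *m N4 - i *: (K1 *m L2 + en *m r) by rewrite -cN4 subKr.
  rewrite mulmxBr mulKmx // -scalemxAr !mulmxBr -scalemxAr !mulmxDr !mulmxA.
  rewrite !(scalerDr, scalerN, scalerA, ii); mx_ring.
rewrite e1 e2 -A2T -N3en ?mulmxA (commmx_inv uA1 uc A1N3); mx_ring.
Qed.

Lemma schur_col2 : schur21 *m A2 + schur22 *m A1 = A1 *m T + invmx A2 *m b *m r.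
Proof.
have e1 : schur22 *m A1 = T *m A1 - L3 *m invmx a *m K2 *m N2.
  by rewrite /schur22 mulmxBl -!mulmxA N2A1 mulKmx.
have e2 : schur21 *m A2 = i *: (L1 *m L2 + L3 *m L4)
    + (L3 *m invmx a *m K2 *m N2 + L3 *m invmx a *m em *m r).
  rewrite /schur21 -scalemxAl mulmxDl -!mulmxA L2A2 mulKmx //.
  have -> : L4 *m A2 = a *m L4 - i *: (K2 *m N2 + em *m r) by rewrite -aL4 subKr.
  rewrite mulmxBr mulKmx // -scalemxAr !mulmxBr -scalemxAr !mulmxDr !mulmxA.
  rewrite !(scalerDr, scalerN, scalerA, ii); mx_ring.
rewrite e1 e2 -A1T -L3em ?mulmxA (commmx_inv uA2 ua A2L3); mx_ring.
Qed.

(** Row counterpart of the two column identities: the equation [A2L1] for [L1] now supplies the rank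
    one term, through [s]. *)
Lemma schur_row : A1 *m schur11 - A2 *m schur21 = T *m A1 + s *m b^T *m invmx A2.
Proof.
have e1 : A1 *m schur11 = A1 *m T - N3 *m K1 *m invmx a *m L2.
  by rewrite /schur11 mulmxBr !mulmxA A1N3 mulmxK.
have e2 : A2 *m schur21 = i *: (L1 *m L2 + L3 *m L4)
    - (N3 *m K1 *m invmx a *m L2 + s *m em^T *m invmx a *m L2).
  rewrite /schur21 -scalemxAr mulmxDr !mulmxA A2L3 mulmxK //.
  have -> : A2 *m L1 = L1 *m a + i *: (N3 *m K1 + s *m em^T) by rewrite -A2L1 addrC subrK.
  rewrite 2!mulmxDl mulmxK // -!scalemxAl !mulmxDl.
  rewrite !(scalerDr, scalerN, scalerA, ii); mx_ring.
rewrite e1 e2 -A1T -emL2 -!mulmxA -(commmx_inv ua uA2 (esym L2A2)); mx_ring.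
Qed.

Lemma det_schur_blocks : \det (block_mx schur11 schur12 schur21 schur22)
  = \det (T + Y *m b *m r) * \det (T + s *m b^T *m Y).
Proof.
set f := T + _; set g := T + _.
have c12 : invmx A1 *m invmx A2 = invmx A2 *m invmx A1.
  by apply: (commmx_inv uA1 uA1); rewrite (commmx_inv uA2 uA2).
(* The column operation produces the second block column of [schur_col1] and [schur_col2]. The row
   operation then kills its upper entry, because [A1] and [A2] commute, and [schur_row] gives the
   upper left entry. *)
have e : block_mx A1 (- A2) 0 1%:M *m (block_mx schur11 schur12 schur21 schur22 *m block_mx 1%:M A2 0 A1)
   = block_mx (g *m A1) 0 schur21 (A1 *m f).
  rewrite !mulmx_block !(mul0mx, mulmx0, mul1mx, mulmx1) ?(add0r, addr0).
  rewrite schur_col1 schur_col2 !mulNmx schur_row; congr block_mx.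
  - by rewrite /g /Y c12 mulmxDl !mulmxA mulmxKV.
  - by rewrite !mulmxDr !mulmxA A12 !mulmxV // !mul1mx subrr.
  - by rewrite /f /Y mulmxDr !mulmxA mulmxV // mul1mx.
have := congr1 determinant e.
rewrite !det_mulmx !det_ublock !det_lblock det1 !det_mulmx mulr1 mul1r => {}e.
have d1 : \det A1 != 0 by rewrite -unitfE -unitmxE.
apply: (mulfI d1); apply: (mulIf d1); rewrite -mulrA e; ring.
Qed.

Lemma det_dispG : \det dispG = (\det a * \det c) ^+ 2
  * (\det (T + Y *m b *m r) / \det T) * (\det (T + s *m b^T *m Y) / \det T).
Proof.
pose R := invmx T.
(* [Dm] is [dispG] without the terms in the inverse of [T]. Its off-diagonal blocks multiply to
   zero, even with the diagonal blocks in between, so its inverse [Di] stops at first order and its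
   determinant is that of the diagonal part. *)
pose Dm := block_mx (block_mx a 0 0 a) (- (i *: block_mx 0 0 K2 0))
                    (- (i *: block_mx 0 0 K1 0)) (block_mx c 0 0 c).
pose Di := block_mx (block_mx (invmx a) 0 0 (invmx a))
                    (i *: block_mx 0 0 (invmx a *m K2 *m invmx c) 0)
                    (i *: block_mx 0 0 (invmx c *m K1 *m invmx a) 0)
                    (block_mx (invmx c) 0 0 (invmx c)).
pose B := block_mx (col_mx L2 L4) 0 0 (col_mx N2 N4).
pose E := block_mx 0 (row_mx N1 N3) (row_mx L1 L3) 0.
pose RR := block_mx R 0 0 R.
have uaa : block_mx a 0 0 a \in unitmx.
  by rewrite unitmxE det_ublock unitrM -!unitmxE ua.
have DmDi : Dm *m Di = 1%:M.
  rewrite /Dm /Di mulmx_block !mulNmx -!scalemxAl -!scalemxAr !mulmx_block.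
  rewrite !(mul0mx, mulmx0) ?(add0r, addr0) !mulmxA !mulmxV // !mul1mx.
  by rewrite !block_mx0 !scaler0 !(oppr0, addr0, subrr, addNr, add0r) -!scalar_mx_block.
have uRR : \det (block_mx T 0 0 T) * \det RR = 1.
  rewrite -det_mulmx mulmx_block !(mul0mx, mulmx0, addr0, add0r) mulmxV //.
  by rewrite -scalar_mx_block det1.
have Gsplit : dispG = Dm *m (1%:M + (i *: (Di *m B)) *m (RR *m E)).
  rewrite mulmxDr mulmx1 -scalemxAl -scalemxAr !mulmxA DmDi mul1mx.
  rewrite /B /RR /E !mulmx_block !(mul0mx, mulmx0, addr0, add0r).
  rewrite scale_block_mx add_block_mx !scaler0 !addr0 /dispG /disp12 /disp21 -/R.
  by rewrite !scalerBr ![- _ + _]addrC.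
have detDm : \det Dm = (\det a * \det c) ^+ 2.
  rewrite det_schur // det_ublock.
  set W := _ *m _ *m _; suff -> : W = 0 by rewrite subr0 det_ublock; ring.
  rewrite /W.
  have -> : invmx (block_mx a 0 0 a) = block_mx (invmx a) 0 0 (invmx a).
    apply: (can_inj (mulKmx uaa)); rewrite mulmxV // mulmx_block.
    by rewrite !(mul0mx, mulmx0, addr0, add0r) mulmxV // -scalar_mx_block.
  rewrite !(mulNmx, mulmxN) -!scalemxAl -!scalemxAr !mulmx_block.
  by rewrite !(mul0mx, mulmx0, addr0, add0r) !block_mx0 !scaler0 !oppr0.
have EDB : i *: (E *m Di *m B) + block_mx T 0 0 T = block_mx schur11 schur12 schur21 schur22.
  rewrite /E /Di /B !mulmx_block !(mul0mx, mulmx0, addr0, add0r).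
  rewrite scale_block_mx add_block_mx !addr0 -!scalemxAr -!scalemxAl !scalerA ii.
  rewrite !mul_row_block !(mul0mx, mulmx0, addr0, add0r) !mul_row_col.
  by rewrite !(mul0mx, mulmx0, addr0, add0r) !scaleN1r ![- _ + _]addrC !mulmxA.
(* Sylvester's identity passes here from size 2(m + n) to size 2N. *)
rewrite Gsplit det_mulmx det_1addmxC detDm.
have -> : 1%:M + RR *m E *m (i *: (Di *m B)) =
   RR *m (i *: (E *m Di *m B) + block_mx T 0 0 T).
  rewrite mulmxDr -scalemxAr -scalemxAr !mulmxA [in RHS]addrC; congr (_ + _).
  rewrite mulmx_block !(mul0mx, mulmx0, addr0, add0r) mulVmx //.
  by rewrite -scalar_mx_block.
have dT : \det T != 0 by rewrite -unitfE -unitmxE.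
have dRR : \det RR = (\det T * \det T)^-1.
  by apply: (mulfI (mulf_neq0 dT dT)); rewrite (mulfV (mulf_neq0 dT dT)) -uRR (det_ublock T).
by rewrite det_mulmx EDB det_schur_blocks dRR; field.
Qed.

Let f := 1 + (r *m invmx T *m Y *m b) 0 0.

(** After a factor [T] is taken out on the right, Sylvester's identity reduces the rank one
    perturbation to size one. *)
Lemma det_rank1 : \det (T + Y *m b *m r) = \det T * f.
Proof.
rewrite -[T in T + _]mul1mx -[Y *m b *m r](mulmxKV uT) -mulmxDl det_mulmx mulrC.
rewrite -[_ *m r *m _]mulmxA [X in _ * X]det_1addmxC [1%:M + _]mx11_scalar det_scalar1.
by rewrite mx_linE mxE mulr1n /f /Y !mulmxA.
Qed.

(** Covers both block rows of [dispG_mul]. Conjugating the displacement equation by the inverse of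
    [T] gives the commutator of [A] with that inverse; its quadratic term cancels against the
    product with the off-diagonal block, as do the terms in [K]. *)
Lemma disp_half p q (d : 'M[F]_p) (e : 'cV[F]_p) (W V : 'M[F]_(p, N)) (A : 'M[F]_N)
    (X Z : 'M[F]_(N, q)) (W' V' : 'M[F]_(q, N)) (K : 'M[F]_(p, q)) :
  W *m A = d *m W ->
  A *m T - T *m A = i *: (X *m W' + Z *m V') ->
  d *m V - V *m A = i *: (K *m W' + e *m r) ->
  block_mx d 0 0 d *m (col_mx W V *m invmx T)
    + i *: (col_mx W V *m invmx T *m row_mx X Z - block_mx 0 0 K 0)
        *m (col_mx W' V' *m invmx T)
  = col_mx W V *m invmx T *m A + i *: (col_mx 0 e *m r *m invmx T).
Proof.
set R := invmx T => WA AT dV.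
have AR : A *m R = R *m A - i *: (R *m row_mx X Z *m (col_mx W' V' *m R)).
  rewrite mulmxA -[R *m _ *m _]mulmxA mul_row_col.
  rewrite scalemxAl scalemxAr -AT mulmxBr mulmxBl.
  by rewrite -!mulmxA mulmxV // mulmx1 mulKmx // subKr.
have eP : block_mx d 0 0 d *m col_mx W V = col_mx W V *m A
    + i *: (col_mx 0 (K *m W') + col_mx 0 (e *m r)).
  rewrite mul_block_col !mul0mx addr0 add0r mul_col_mx WA add_col_mx addr0.
  by rewrite scale_col_mx scaler0 -dV add_col_mx addr0 addrC subrK.
have eK : (block_mx 0 0 K 0 : 'M_(p + p, q + q)) *m col_mx W' V' = col_mx 0 (K *m W').
  by rewrite mul_block_col !mul0mx !addr0.
rewrite mulmxA eP mulmxDl -[_ *m A *m R]mulmxA AR mulmxBr -!scalemxAl mulmxBl.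
have -> : @col_mx _ p p _ 0 (e *m r) = col_mx 0 e *m r by rewrite mul_col_mx mul0mx.
rewrite [block_mx 0 0 K 0 *m _]mulmxA eK [(_ + _) *m R]mulmxDl -scalemxAr !mulmxA.
mx_ring.
Qed.

(* [G * hGamma], with [hGamma = hPi * T^-1], is diagonal up to the rank one term in [r]. *)
Lemma dispG_mul :
  dispG *m (col_mx (col_mx L2 L4) (col_mx N2 N4) *m invmx T)
  = col_mx (col_mx L2 L4 *m invmx T *m A2) (col_mx N2 N4 *m invmx T *m A1)
    + i *: (col_mx (col_mx 0 em) (col_mx 0 en) *m r *m invmx T).
Proof.
rewrite /dispG [col_mx (col_mx L2 L4) _ *m _]mul_col_mx mul_block_col (disp_half L2A2 A2T aL4).
rewrite [disp21 *m _ + _]addrC (disp_half N2A1 A1T cN4).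
rewrite -add_col_mx -scale_col_mx !mul_col_mx; reflexivity.
Qed.

(** By [dispG_mul] the first summand leaves two residues, with one resolvent each, and the term in f
    - 1. The second summand gives the missing 1 through the diagonal blocks, and through [N3en] and
    [L3em] its off-diagonal part cancels the residues, as i squared is -1. *)
Lemma dispG_solve :
  dispG *m (col_mx (col_mx L2 L4) (col_mx N2 N4) *m invmx T *m invmx A2 *m invmx A1 *m b
            + i *: col_mx (col_mx 0 (invmx a *m em)) (col_mx 0 (invmx c *m en)))
  = (i * f) *: col_mx (col_mx 0 em) (col_mx 0 en).
Proof.
have c12 : invmx A1 *m invmx A2 = invmx A2 *m invmx A1.
  by apply: (commmx_inv uA1 uA1); rewrite (commmx_inv uA2 uA2).
set E := col_mx (col_mx 0 em) (col_mx 0 en).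
have fE : E *m r *m invmx T *m invmx A2 *m invmx A1 *m b = (f - 1) *: E.
  rewrite -!mulmxA [X in _ *m X]mx11_scalar mul_mx_scalar; congr (_ *: _).
  by rewrite /f /Y c12 !mulmxA addrC addKr.
rewrite mulmxDr !mulmxA -[dispG *m _ *m _]mulmxA dispG_mul !mulmxDl -!scalemxAl -scalemxAr.
rewrite fE /dispG mul_block_col.
rewrite [(block_mx a 0 0 a) *m _]mul_block_col [(block_mx c 0 0 c) *m _]mul_block_col.
rewrite !(mul0mx, mulmx0, add0r) !mulKVmx // -/E.
rewrite /disp12 /disp21.
rewrite -!scalemxAl !mulmxBl -!mulmxA !mul_row_col !mul_block_col.
rewrite !(mul0mx, mulmx0, add0r).
have -> : N3 *m (invmx c *m en) = invmx A1 *m b.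
  by rewrite mulmxA -(commmx_inv uA1 uc A1N3) -mulmxA N3en.
have -> : L3 *m (invmx a *m em) = invmx A2 *m b.
  by rewrite mulmxA -(commmx_inv uA2 ua A2L3) -mulmxA L3em.
rewrite [X in X + _ + _]mul_col_mx -!mulmxA mulKVmx //.
rewrite [invmx A2 *m (invmx A1 *m b)]mulmxA -c12 -mulmxA mulKVmx //.
rewrite [i *: _ + col_mx 0 en]addrC [col_mx 0 em + _]addrC [col_mx 0 en + _]addrC.
rewrite !col_mx0 !subr0.
set u := col_mx L2 L4 *m _; set v := col_mx N2 N4 *m _.
have -> : col_mx (i *: u + col_mx 0 em) (i *: v + col_mx 0 en) = i *: col_mx u v + E.
  by rewrite scale_col_mx add_col_mx.
rewrite !(scalerDr, scalerA, ii); mx_ring.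
Qed.
End Displacement.

(** * Half-sums of Toeplitz coefficients *)

Section HalfSums.
Variable R : realType.
Local Notation C := (R[i]).
Local Notation iC := (iC R).
Local Notation halfC := (halfC R).

Lemma iCiC : iC * iC = -1.
Proof. by rewrite -expr2; exact: sqr_i. Qed.

Lemma halfC_add : halfC + halfC = 1.
Proof. by rewrite -mulr2n -mulr_natl mulfV // pnatr_eq0. Qed.

Lemma conj_iC : conjc iC = - iC.
Proof. by rewrite /conjc /Defs.iC; apply/eqP; rewrite eq_complex /= oppr0 !eqxx. Qed.

Lemma conj_halfC : conjc halfC = halfC.
Proof. by rewrite /Defs.halfC fmorphV rmorph_nat. Qed.

Lemma aaE (i k : nat) :
  aa R (zd i k) = iC * (if (k < i)%N then 1 else if k == i then halfC else 0).
Proof.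
rewrite /aa /zd subr_lt0 subr_eq0 ltz_nat eqz_nat eq_sym.
by case: ltngtP => _; rewrite ?(mulr0, mulr1) // mulrC.
Qed.

Lemma conj_aaE (i k : nat) :
  conjc (aa R (zd i k)) = - iC * (if (k < i)%N then 1 else if k == i then halfC else 0).
Proof.
have cM x y : conjc (x * y : C) = conjc x * conjc y by exact: rmorphM.
rewrite aaE cM conj_iC; congr (_ * _).
by case: ifP => _; [exact: rmorph1 | case: ifP => _; [exact: conj_halfC | exact: rmorph0]].
Qed.

(** The common shape of the entries of the matrices M and, iterated, of [K11] and [K12]. *)
Definition hsum (f : nat -> C) k := halfC * f 0%N + \sum_(1 <= s < k.+1) f s.

Lemma hsum_swap f k l :
  hsum (fun s => hsum (f s) l) k = hsum (fun s' => hsum (f^~ s') k) l.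
Proof.
rewrite /hsum !big_split /= -!mulr_sumr exchange_big /=; ring.
Qed.

Lemma sum_weight p (i : 'I_p) (g : nat -> C) :
  \sum_(k < p) (if (k < i)%N then 1 else if k == i :> nat then halfC else 0) * g k
  = halfC * g i + \sum_(0 <= k < i) g k.
Proof.
rewrite (bigD1 i) //= ltnn eqxx; congr (_ + _).
rewrite big_mkord (big_ord_widen p g (ltnW (ltn_ord i))).
rewrite [LHS]big_mkcond [RHS]big_mkcond /=; apply: eq_bigr => k _ /=.
by rewrite -val_eqE /=; case: ltngtP; rewrite ?(mul1r, mul0r).
Qed.

(** The entry (i, j), those above it in its column and those left of it in its row meet each
    diagonal from -j to i exactly once. *)
Lemma toeplitz_sum (f : int -> C) i j :
  f (zd i j) + \sum_(0 <= k < i) f (zd k j) + \sum_(0 <= k < j) f (zd i k)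
  = f 0 + \sum_(1 <= s < i.+1) f s%:Z + \sum_(1 <= s < j.+1) f (- s%:Z).
Proof.
have zdSS a b : zd a.+1 b.+1 = zd a b by rewrite /zd; lia.
have zd0 a : zd a 0 = a by rewrite /zd subr0.
have recl (g : nat -> C) k : g k + \sum_(0 <= s < k) g s = g 0%N + \sum_(1 <= s < k.+1) g s.
  by rewrite addrC -big_nat_recr //= big_nat_recl //= big_add1.
elim: j => [|j IH].
  rewrite [\sum_(0 <= k < 0) _]big_geq // [\sum_(1 <= s < 1) _]big_geq // !addr0.
  rewrite (recl (fun k => f (zd k 0))) zd0; congr (_ + _).
  by apply: eq_bigr => k _; rewrite zd0.
rewrite [\sum_(1 <= s < j.+2) _]big_nat_recr //= addrA -IH.
rewrite (recl (fun k => f (zd k j.+1))) big_add1 /= [\sum_(0 <= k < j.+1) _]big_nat_recr //=.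
under eq_bigr do rewrite zdSS.
have -> : zd 0 j.+1 = - j.+1%:Z by rewrite /zd sub0r.
ring.
Qed.

(** A full row meets the diagonals from -q to i once, and each half-sum takes half of diagonal 0.
    Hence a half-sum minus a full row is minus the half-sum from the other end. *)
Lemma row_sum (f : int -> C) i q :
  \sum_(0 <= k < (i + q).+1) f (zd i k)
  = hsum (fun s => f s%:Z) i + hsum (fun s => f (- s%:Z)) q.
Proof.
have -> : hsum (fun s => f s%:Z) i + hsum (fun s => f (- s%:Z)) q
   = f 0 + \sum_(1 <= s < i.+1) f s%:Z + \sum_(1 <= s < q.+1) f (- s%:Z).
  by rewrite /hsum oppr0 -[f 0 in RHS]mul1r -halfC_add; ring.
elim: i => [|i IH].
  rewrite [\sum_(1 <= s < 1) _]big_geq // addr0 big_nat_recl // big_add1.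
  by congr (_ + _); apply: eq_bigr => k _; rewrite /zd sub0r.
rewrite addSn big_nat_recl // [\sum_(1 <= s < i.+2) _]big_nat_recr //=.
rewrite (eq_bigr (fun k => f (zd i k))) => [|k _]; last by congr f; rewrite /zd; lia.
by rewrite IH {1}/zd subr0; ring.
Qed.

(** The displacement equation in one index, from which all the block versions follow. Each product
    is a partial sum with weight one half at f(i - j); the two halves add up to the full entry that
    [toeplitz_sum] requires. *)
Lemma toeplitz_commutator p (f : int -> C) (i j : 'I_p) :
  \sum_(k < p) aa R (zd i k) * f (zd k j) - \sum_(k < p) f (zd i k) * conjc (aa R (zd j k))
  = iC * (hsum (fun s => f s%:Z) i + hsum (fun s => f (- s%:Z)) j).
Proof.
transitivity (iC * (halfC * f (zd i j) + \sum_(0 <= k < i) f (zd k j))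
  + iC * (halfC * f (zd i j) + \sum_(0 <= k < j) f (zd i k))).
  rewrite -(sum_weight i (fun k => f (zd k j))) -(sum_weight j (fun k => f (zd i k))).
  rewrite !mulr_sumr -sumrN; congr (_ + _); apply: eq_bigr => k _.
    by rewrite aaE mulrA.
  by rewrite conj_aaE; ring.
rewrite /hsum oppr0 -mulrDr; congr (_ * _).
rewrite addrACA -mulrDl halfC_add mul1r addrA toeplitz_sum -[f 0 in LHS]mul1r -halfC_add; ring.
Qed.

End HalfSums.

(** * Block indices and reversal *)

Lemma sum_mxtens (V : nmodType) n m (F : 'I_(n * m) -> V) :
  \sum_I F I = \sum_k \sum_l F (mxtens_index (k, l)).
Proof.
rewrite pair_big (reindex (@mxtens_index n m)) /=; first by apply: eq_bigr => -[].
by exists mxtens_unindex => ? _; rewrite (mxtens_indexK, mxtens_unindexK).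
Qed.

Lemma rev_mxtens_index n m (i : 'I_n) (j : 'I_m) :
  rev_ord (mxtens_index (i, j)) = mxtens_index (rev_ord i, rev_ord j).
Proof.
by apply: val_inj => /=; case: i j => i hi [j hj] /=; nia.
Qed.

Section Flip.
Variable F : pzRingType.

Definition flip p : 'M[F]_p := \matrix_(i, j) (j == rev_ord i)%:R.

Lemma mul_flip_mx p q (X : 'M_(p, q)) i j : (flip p *m X) i j = X (rev_ord i) j.
Proof.
rewrite mxE (bigD1 (rev_ord i)) //= big1 => [|k /negPf e]; rewrite mxE ?eqxx ?mul1r ?addr0 //.
by rewrite e mul0r.
Qed.

Lemma flip_tr p : (flip p)^T = flip p.
Proof. by apply/matrixP => i j; rewrite !mxE -(inj_eq rev_ord_inj) rev_ordK eq_sym. Qed.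

Lemma mul_mx_flip p q (X : 'M_(p, q)) i j : (X *m flip q) i j = X i (rev_ord j).
Proof.
rewrite mxE (bigD1 (rev_ord j)) //= big1 => [|k /negPf e];
  rewrite -flip_tr !mxE ?eqxx ?mulr1 ?addr0 //.
by rewrite e mulr0.
Qed.

Lemma flipK p : flip p *m flip p = 1%:M.
Proof. by apply/matrixP => i j; rewrite mul_flip_mx !mxE rev_ordK eq_sym. Qed.

Lemma flip_const p q (x : F) : flip p *m const_mx x = const_mx x :> 'M_(p, q).
Proof. by apply/matrixP => i j; rewrite mul_flip_mx !mxE. Qed.

Lemma const_flip p q (x : F) : const_mx x *m flip q = const_mx x :> 'M_(p, q).
Proof. by apply/matrixP => i j; rewrite mul_mx_flip !mxE. Qed.

End Flip.

(** * Matrices acting on one of the two block indices *)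

Section Blocks.
Variable R : realType.
Local Notation C := (R[i]).
Local Notation iC := (iC R).
Variables n m : nat.
Local Notation ix i j := (@mxtens_index n m (i, j)).
Local Notation A1 := (A1 R n m).
Local Notation A2 := (A2 R n m).
Local Notation M21 := (M21 R n m).
Local Notation M31 := (M31 R n m).
Local Notation M22 := (M22 R n m).
Local Notation M32 := (M32 R n m).

Lemma UmxE p : Umx R p = block_mx 0 (flip C p) (flip C p) 0.
Proof.
apply/matrixP => i j; rewrite !mxE; case: splitP => i' ->; rewrite mxE; case: splitP => j' ->;
  rewrite mxE -?val_eqE /=; have := ltn_ord i'; have := ltn_ord j'.
- by case: eqP => //; lia.
- by move=> ? ?; case: eqP => ?; case: eqP => ? //; lia.
- by move=> ? ?; case: eqP => ?; case: eqP => ? //; lia.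
- by case: eqP => //; lia.
Qed.

Lemma blk_index i j : blk (ix i j) = i.
Proof. exact: (congr1 (fun u => val u.1) (mxtens_indexK (i, j))). Qed.

Lemma inn_index i j : inn (ix i j) = j.
Proof. exact: (congr1 (fun u => val u.2) (mxtens_indexK (i, j))). Qed.

Definition idxE := (blk_index, inn_index).

Lemma adjmxE p q (X : 'M[C]_(p, q)) i j : adjmx X i j = conjc (X j i).
Proof. by rewrite !mxE. Qed.

Lemma mul_A1 p (X : 'M_(n * m, p)) i j l :
  (A1 *m X) (ix i j) l = \sum_(k < n) aa R (zd i k) * X (ix k j) l.
Proof.
rewrite mxE sum_mxtens; apply: eq_bigr => k _.
rewrite (bigD1 j) //= big1 ?addr0 => [|j' ne]; rewrite mxE !idxE ?eqxx //.
by rewrite val_eqE eq_sym (negPf ne) mul0r.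
Qed.

Lemma mul_A2 p (X : 'M_(n * m, p)) i j l :
  (A2 *m X) (ix i j) l = \sum_(k < m) aa R (zd j k) * X (ix i k) l.
Proof.
rewrite mxE sum_mxtens (bigD1 i) //= [X in _ + X]big1 ?addr0 => [|i' ne].
  by apply: eq_bigr => k _; rewrite mxE !idxE eqxx.
by rewrite big1 // => k _; rewrite mxE !idxE val_eqE eq_sym (negPf ne) mul0r.
Qed.

Lemma mul_A1adj p (X : 'M_(p, n * m)) i j l :
  (X *m adjmx A1) l (ix i j) = \sum_(k < n) X l (ix k j) * conjc (aa R (zd i k)).
Proof.
rewrite mxE sum_mxtens; apply: eq_bigr => k _.
rewrite (bigD1 j) //= big1 ?addr0 => [|j' ne]; rewrite adjmxE mxE !idxE ?eqxx //.
by rewrite val_eqE eq_sym (negPf ne) [conjc _]rmorph0 mulr0.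
Qed.

Lemma mul_A2adj p (X : 'M_(p, n * m)) i j l :
  (X *m adjmx A2) l (ix i j) = \sum_(k < m) X l (ix i k) * conjc (aa R (zd j k)).
Proof.
rewrite mxE sum_mxtens (bigD1 i) //= [X in _ + X]big1 ?addr0 => [|i' ne].
  by apply: eq_bigr => k _; rewrite adjmxE mxE !idxE eqxx.
by rewrite big1 // => k _; rewrite adjmxE mxE !idxE val_eqE eq_sym (negPf ne) [conjc _]rmorph0 mulr0.
Qed.

Lemma M21_ix l i j : M21 l (ix i j) = (l == j)%:R.
Proof. by rewrite mxE idxE val_eqE; case: eqP. Qed.

Lemma M22_ix l i j : M22 l (ix i j) = (l == i)%:R.
Proof. by rewrite mxE idxE val_eqE; case: eqP. Qed.

Lemma M31E : M31 = M21^T.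
Proof.
apply/matrixP => I j; rewrite adjmxE [RHS]mxE mxE; case: ifP => _.
  exact: rmorph1.
exact: rmorph0.
Qed.

Lemma M32E : M32 = M22^T.
Proof.
apply/matrixP => I j; rewrite adjmxE [RHS]mxE mxE; case: ifP => _.
  exact: rmorph1.
exact: rmorph0.
Qed.

Lemma mul_mx_M21 p (X : 'M_(p, m)) i j l : (X *m M21) l (ix i j) = X l j.
Proof.
rewrite mxE (bigD1 j) //= big1 => [|k /negPf ne]; rewrite M21_ix ?eqxx ?mulr1 ?addr0 //.
by rewrite ne mulr0.
Qed.

Lemma mul_mx_M22 p (X : 'M_(p, n)) i j l : (X *m M22) l (ix i j) = X l i.
Proof.
rewrite mxE (bigD1 i) //= big1 => [|k /negPf ne]; rewrite M22_ix ?eqxx ?mulr1 ?addr0 //.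
by rewrite ne mulr0.
Qed.

Lemma mul_M31_mx p (X : 'M_(m, p)) i j l : (M31 *m X) (ix i j) l = X j l.
Proof. by rewrite M31E -[_ *m X]trmxK trmx_mul trmxK mxE mul_mx_M21 mxE. Qed.

Lemma mul_M32_mx p (X : 'M_(n, p)) i j l : (M32 *m X) (ix i j) l = X i l.
Proof. by rewrite M32E -[_ *m X]trmxK trmx_mul trmxK mxE mul_mx_M22 mxE. Qed.

Lemma mul_mx_M31 p (X : 'M_(p, n * m)) l j : (X *m M31) l j = \sum_i X l (ix i j).
Proof.
rewrite mxE sum_mxtens; apply: eq_bigr => i _.
rewrite (bigD1 j) //= big1 => [|k /negPf ne]; rewrite M31E mxE M21_ix.
  by rewrite eqxx mulr1 addr0.
by rewrite eq_sym ne mulr0.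
Qed.

Lemma mul_mx_M32 p (X : 'M_(p, n * m)) l i : (X *m M32) l i = \sum_j X l (ix i j).
Proof.
rewrite mxE sum_mxtens (bigD1 i) //= [X in _ + X]big1 ?addr0 => [|i' ne].
  by apply: eq_bigr => k _; rewrite M32E mxE M22_ix eqxx mulr1.
by rewrite big1 // => k _; rewrite M32E mxE M22_ix eq_sym (negPf ne) mulr0.
Qed.

Lemma mx_ixP p (X Y : 'M[C]_(n * m, p)) :
  (forall i j l, X (ix i j) l = Y (ix i j) l) -> X = Y.
Proof. by move=> e; apply/matrixP => I l; case: (mxtens_indexP I). Qed.

Lemma M21_ones : const_mx 1 *m M21 = const_mx 1 :> 'rV_(n * m).
Proof. by apply: trmx_inj; apply: mx_ixP => i j l; rewrite mxE mul_mx_M21 !mxE. Qed.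

Lemma M31_ones : M31 *m const_mx 1 = const_mx 1 :> 'cV_(n * m).
Proof. by apply: mx_ixP => i j l; rewrite mul_M31_mx !mxE. Qed.

Lemma M32_ones : M32 *m const_mx 1 = const_mx 1 :> 'cV_(n * m).
Proof. by apply: mx_ixP => i j l; rewrite mul_M32_mx !mxE. Qed.

Lemma M21M32 : M21 *m M32 = const_mx 1.
Proof.
apply/matrixP => j i; rewrite mul_mx_M32 (bigD1 j) //= big1 => [|k /negPf ne].
  by rewrite M21_ix eqxx addr0 mxE.
by rewrite M21_ix eq_sym ne.
Qed.

Lemma M22M31 : M22 *m M31 = const_mx 1.
Proof. by rewrite -[LHS]trmxK trmx_mul -M32E M31E trmxK M21M32 trmx_const. Qed.

Lemma A1M32 : A1 *m M32 = M32 *m A1s R n.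
Proof.
apply: mx_ixP => i j l; rewrite mul_M32_mx mul_A1 mxE (bigD1 l) //= big1 => [|k /negPf ne].
  by rewrite M32E mxE M22_ix eqxx mulr1 addr0.
by rewrite M32E mxE M22_ix eq_sym ne mulr0.
Qed.

Lemma A2M31 : A2 *m M31 = M31 *m A2s R m.
Proof.
apply: mx_ixP => i j l; rewrite mul_M31_mx mul_A2 mxE (bigD1 l) //= big1 => [|k /negPf ne].
  by rewrite M31E mxE M21_ix eqxx mulr1 addr0.
by rewrite M31E mxE M21_ix eq_sym ne mulr0.
Qed.

Lemma A12 : A1 *m A2 = A2 *m A1.
Proof.
apply: mx_ixP => i j; move=> K; case: (mxtens_indexP K) => k l.
rewrite mul_A1 mul_A2 (bigD1 k) // [RHS](bigD1 l) //=.
rewrite [X in _ + X = _]big1 => [|k' /negPf ne]; last by rewrite mxE !idxE val_eqE ne mulr0.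
rewrite [X in _ = _ + X]big1 => [|l' /negPf ne]; last by rewrite mxE !idxE val_eqE ne mulr0.
by rewrite !mxE !idxE !eqxx !addr0 mulrC.
Qed.

(** Off the diagonal exactly one of the two terms is nonzero; on it the two halves add up. This
    makes the skew-Hermitian part a multiple of an all-ones matrix. *)
Lemma aa_sub_conj (i k : nat) : aa R (zd i k) - conjc (aa R (zd k i)) = iC.
Proof.
rewrite aaE conj_aaE; case: ltngtP => _; rewrite ?(mulr0, mulr1, subr0, opprK, add0r) //.
by rewrite mulNr opprK -mulrDr halfC_add mulr1.
Qed.

Lemma A1s_adj p : A1s R p - adjmx (A1s R p) = iC *: const_mx 1.
Proof. by apply/matrixP => i j; rewrite !mx_linE adjmxE !mxE aa_sub_conj mulr1. Qed.

Lemma A1_adj : A1 - adjmx A1 = iC *: (M31 *m M21).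
Proof.
apply: mx_ixP => i j; move=> K; case: (mxtens_indexP K) => k l.
rewrite !mx_linE adjmxE mul_mx_M21 M31E [_^T _ _]mxE M21_ix !mxE !idxE !val_eqE [j == l]eq_sym.
case: eqP => _; first by rewrite aa_sub_conj mulr1.
by rewrite [conjc _]rmorph0 mulr0 subr0.
Qed.

Lemma A2_adj : A2 - adjmx A2 = iC *: (M32 *m M22).
Proof.
apply: mx_ixP => i j; move=> K; case: (mxtens_indexP K) => k l.
rewrite !mx_linE adjmxE mul_mx_M22 M32E [_^T _ _]mxE M22_ix !mxE !idxE !val_eqE [i == k]eq_sym.
case: eqP => _; first by rewrite aa_sub_conj mulr1.
by rewrite [conjc _]rmorph0 mulr0 subr0.
Qed.

(** Reversing both indices negates their difference and transposition restores it: Toeplitz matrices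
    are persymmetric. The same argument gives the versions for [A1], [A2] and [T]. *)
Lemma flip_A1s p : flip C p *m (A1s R p)^T *m flip C p = A1s R p.
Proof.
apply/matrixP => i j; rewrite mul_mx_flip mul_flip_mx !mxE /=; congr aa.
by have := ltn_ord i; have := ltn_ord j; rewrite /zd; lia.
Qed.

Lemma flip_A2s p : flip C p *m (A2s R p)^T *m flip C p = A2s R p.
Proof.
apply/matrixP => i j; rewrite mul_mx_flip mul_flip_mx !mxE /=; congr aa.
by have := ltn_ord i; have := ltn_ord j; rewrite /zd; lia.
Qed.

Lemma flip_A1 : flip C (n * m) *m A1^T *m flip C (n * m) = A1.
Proof.
apply: mx_ixP => i j; move=> K; case: (mxtens_indexP K) => k l.
rewrite mul_mx_flip mul_flip_mx !rev_mxtens_index !mxE !idxE !val_eqE.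
rewrite (inj_eq rev_ord_inj) eq_sym; case: ifP => // _; congr aa.
by have := ltn_ord i; have := ltn_ord k; rewrite /zd /=; lia.
Qed.

Lemma flip_A2 : flip C (n * m) *m A2^T *m flip C (n * m) = A2.
Proof.
apply: mx_ixP => i j; move=> K; case: (mxtens_indexP K) => k l.
rewrite mul_mx_flip mul_flip_mx !rev_mxtens_index !mxE !idxE !val_eqE.
rewrite (inj_eq rev_ord_inj) eq_sym; case: ifP => // _; congr aa.
by have := ltn_ord j; have := ltn_ord l; rewrite /zd /=; lia.
Qed.

Lemma flip_M21 : flip C m *m M21 = M21 *m flip C (n * m).
Proof.
apply/matrixP => j K; case: (mxtens_indexP K) => k l.
rewrite mul_mx_flip mul_flip_mx rev_mxtens_index !M21_ix.
by rewrite -(inj_eq rev_ord_inj) rev_ordK.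
Qed.

Lemma flip_M22 : flip C n *m M22 = M22 *m flip C (n * m).
Proof.
apply/matrixP => j K; case: (mxtens_indexP K) => k l.
rewrite mul_mx_flip mul_flip_mx rev_mxtens_index !M22_ix.
by rewrite -(inj_eq rev_ord_inj) rev_ordK.
Qed.

Lemma flip_M31 : flip C (n * m) *m M31 = M31 *m flip C m.
Proof. by rewrite M31E -[flip C (n * m)]flip_tr -[flip C m]flip_tr -!trmx_mul flip_M21. Qed.

Lemma flip_M32 : flip C (n * m) *m M32 = M32 *m flip C n.
Proof. by rewrite M32E -[flip C (n * m)]flip_tr -[flip C n]flip_tr -!trmx_mul flip_M22. Qed.

Lemma flip_swap p q (X : 'M[C]_(p, q)) Y :
  flip C p *m X *m flip C q = Y -> X = flip C p *m Y *m flip C q.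
Proof. by move=> <-; rewrite !mulmxA flipK mul1mx -mulmxA flipK mulmx1. Qed.

Lemma tr_M22 : M22^T = M32. Proof. by rewrite M32E. Qed.
Lemma tr_M21 : M21^T = M31. Proof. by rewrite M31E. Qed.

(** The transpose of [A1M32], by persymmetry of both shift matrices. *)
Lemma M22A1 : M22 *m A1 = A1s R n *m M22.
Proof.
apply: trmx_inj; rewrite !trmx_mul tr_M22 (flip_swap flip_A1) (flip_swap (flip_A1s n)).
rewrite -!mulmxA flip_M32 (mulmxA A1) A1M32 -(mulmxA M32) (mulmxA _ M32) flip_M32.
by rewrite -!mulmxA.
Qed.

Lemma M21A2 : M21 *m A2 = A2s R m *m M21.
Proof.
apply: trmx_inj; rewrite !trmx_mul tr_M21 (flip_swap flip_A2) (flip_swap (flip_A2s m)).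
rewrite -!mulmxA flip_M31 (mulmxA A2) A2M31 -(mulmxA M31) (mulmxA _ M31) flip_M31.
by rewrite -!mulmxA.
Qed.

End Blocks.

(** * Displacement equations *)

Section Displacements.
Variable R : realType.
Local Notation C := (R[i]).
Local Notation iC := (iC R).
Variables n m : nat.
Variable t : int -> int -> C.
Local Notation ix i j := (@mxtens_index n m (i, j)).
Local Notation A1 := (A1 R n m).
Local Notation A2 := (A2 R n m).
Local Notation M21 := (M21 R n m).
Local Notation M31 := (M31 R n m).
Local Notation M22 := (M22 R n m).
Local Notation M32 := (M32 R n m).
Local Notation T := (TBT n m t).
Local Notation M11 := (M11 n m t).
Local Notation M41 := (M41 n m t).
Local Notation M12 := (M12 n m t).
Local Notation M42 := (M42 n m t).
Local Notation K11 := (K11 n m t).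
Local Notation K12 := (K12 n m t).
Local Notation flip := (flip C).

Lemma row_sum_ord p (f : int -> C) (i : 'I_p) :
  \sum_(k < p) f (zd i k) = hsum (fun s => f s%:Z) i + hsum (fun s => f (- s%:Z)) (rev_ord i).
Proof.
rewrite -row_sum /= -(big_mkord predT (fun k => f (zd i k))).
by congr (\sum_(0 <= k < _) _); have := ltn_ord i; lia.
Qed.

Lemma zd_rev p (i j : 'I_p) : zd (rev_ord i) (rev_ord j) = zd j i.
Proof. by have := ltn_ord i; have := ltn_ord j; rewrite /zd /=; lia. Qed.

Lemma TBT_ix i j k l : T (ix i j) (ix k l) = t (zd i k) (zd j l).
Proof. by rewrite mxE !idxE. Qed.

Lemma M11_ix i j l : M11 (ix i j) l = hsum (fun s => t s%:Z (zd j l)) i.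
Proof. by rewrite mxE !idxE. Qed.

Lemma M41_ix j k l : M41 j (ix k l) = hsum (fun s => t (- s%:Z) (zd j l)) k.
Proof. by rewrite mxE !idxE /hsum oppr0. Qed.

Lemma M12_ix i j k : M12 (ix i j) k = hsum (fun s => t (zd i k) s%:Z) j.
Proof. by rewrite mxE !idxE. Qed.

Lemma cM42E r l : cM42 t r l = hsum (fun s => t r (- s%:Z)) l.
Proof. by rewrite /hsum oppr0. Qed.

Lemma M42_ix i k l : M42 i (ix k l) = hsum (fun s => t (zd i k) (- s%:Z)) l.
Proof. by rewrite mxE !idxE cM42E. Qed.

(** The same double half-sums arise from [M41] and from [M42], because the two summations commute.
    Hence a single row [corner_row] gives the rank one term in both [A2M41_adj] and [A1M42_adj]. *)
Definition corner k l : C := hsum (fun s => hsum (fun s' => t (- s%:Z) (- s'%:Z)) l) k.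
Definition corner_row : 'rV[C]_(n * m) := \row_I corner (blk I) (inn I).

(* The half-sums of these matrices run over the complementary range of indices, with opposite
   sign; this replaces [A_p^*] by [A_p] in the displacement equations. *)
Definition compM11 := M11 - T *m M31.
Definition compM12 := M12 - T *m M32.
Definition compK11 := K11 - M42 *m M31.
Definition compK12 := K12 - M41 *m M32.

(** Multiplication by [M31] sums a full row over the block index, so [row_sum_ord] leaves minus the
    half-sum from the opposite end, an entry of [M41] at reversed indices. *)
Lemma compM11E : compM11 = - (flip (n * m) *m M41^T *m flip m).
Proof.
apply: mx_ixP => i j l; rewrite !mx_linE mul_mx_flip mul_flip_mx rev_mxtens_index [_^T _ _]mxE M41_ix.
rewrite M11_ix mul_mx_M31 zd_rev; under eq_bigr do rewrite TBT_ix.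
by rewrite (row_sum_ord (fun x => t x (zd j l))) opprD addrA subrr add0r.
Qed.

Lemma compM12E : compM12 = - (flip (n * m) *m M42^T *m flip n).
Proof.
apply: mx_ixP => i j k; rewrite !mx_linE mul_mx_flip mul_flip_mx rev_mxtens_index [_^T _ _]mxE M42_ix.
rewrite M12_ix mul_mx_M32 zd_rev; under eq_bigr do rewrite TBT_ix.
by rewrite (row_sum_ord (fun x => t (zd i k) x)) opprD addrA subrr add0r.
Qed.

Lemma compK11_corner i l : compK11 i l = - corner (rev_ord i) l.
Proof.
rewrite !mx_linE mul_mx_M31; under eq_bigr do rewrite mxE idxE idxE.
rewrite (row_sum_ord (fun x => cM42 t x l)) mxE opprD addrA subrr add0r.
by congr (- _).
Qed.

Lemma K12E j k : K12 j k = hsum (fun s => hsum (fun s' => t (- s%:Z) s'%:Z) j) k.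
Proof. by rewrite mxE /hsum oppr0. Qed.

Lemma K11E i l : K11 i l = hsum (fun s => hsum (fun s' => t s%:Z (- s'%:Z)) l) i.
Proof. by rewrite mxE /hsum oppr0. Qed.

Lemma compK12_corner j k : compK12 j k = - corner k (rev_ord j).
Proof.
rewrite !mx_linE mul_mx_M32; under eq_bigr do rewrite M41_ix.
rewrite (row_sum_ord (fun x => hsum (fun s => t (- s%:Z) x) k)) K12E hsum_swap.
by rewrite opprD addrA subrr add0r /corner [in RHS]hsum_swap.
Qed.

(** Both sides are minus the numbers [corner], listed in differently reversed orders. *)
Lemma compK11E : compK11 = flip n *m compK12^T *m flip m.
Proof.
apply/matrixP => i l; rewrite mul_mx_flip mul_flip_mx [_^T _ _]mxE.
by rewrite compK11_corner compK12_corner rev_ordK.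
Qed.

Lemma flip_T : flip (n * m) *m T^T *m flip (n * m) = T.
Proof.
apply: mx_ixP => i j; move=> K; case: (mxtens_indexP K) => k l.
by rewrite mul_mx_flip mul_flip_mx !rev_mxtens_index [_^T _ _]mxE !TBT_ix !zd_rev.
Qed.

(** [toeplitz_commutator] in the block index, with the inner indices fixed. *)
Lemma A1T_adj : A1 *m T - T *m adjmx A1 = iC *: (M11 *m M21 + M31 *m M41).
Proof.
apply: mx_ixP => i j; move=> K; case: (mxtens_indexP K) => k l.
rewrite !mx_linE mul_A1 mul_A1adj mul_mx_M21 mul_M31_mx M11_ix M41_ix.
under eq_bigr do rewrite TBT_ix; under [X in _ - X]eq_bigr do rewrite TBT_ix.
exact: (toeplitz_commutator (fun x => t x (zd j l))).
Qed.

Lemma A2T_adj : A2 *m T - T *m adjmx A2 = iC *: (M12 *m M22 + M32 *m M42).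
Proof.
apply: mx_ixP => i j; move=> K; case: (mxtens_indexP K) => k l.
rewrite !mx_linE mul_A2 mul_A2adj mul_mx_M22 mul_M32_mx M12_ix M42_ix.
under eq_bigr do rewrite TBT_ix; under [X in _ - X]eq_bigr do rewrite TBT_ix.
exact: (toeplitz_commutator (fun x => t (zd i k) x)).
Qed.

Lemma mul_ones_corner p (j : 'I_p) k l :
  ((const_mx 1 : 'cV_p) *m corner_row) j (ix k l) = corner k l.
Proof. by rewrite mxE big_ord1 !mxE mul1r !idxE. Qed.

Lemma A2M41_adj : A2s R m *m M41 - M41 *m adjmx A2
  = iC *: (K12 *m M22 + const_mx 1 *m corner_row).
Proof.
apply/matrixP => j K; case: (mxtens_indexP K) => k l.
rewrite !mx_linE mul_A2adj mul_mx_M22 mul_ones_corner [(_ *m M41) _ _]mxE.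
under eq_bigr do rewrite M41_ix mxE; under [X in _ - X]eq_bigr do rewrite M41_ix.
rewrite (toeplitz_commutator (fun x => hsum (fun s => t (- s%:Z) x) k)) K12E.
by congr (_ * (_ + _)); rewrite ?/corner [RHS]hsum_swap.
Qed.

Lemma A1M42_adj : A1s R n *m M42 - M42 *m adjmx A1
  = iC *: (K11 *m M21 + const_mx 1 *m corner_row).
Proof.
apply/matrixP => i K; case: (mxtens_indexP K) => k l.
rewrite !mx_linE mul_A1adj mul_mx_M21 mul_ones_corner [(_ *m M42) _ _]mxE.
under eq_bigr do rewrite M42_ix mxE; under [X in _ - X]eq_bigr do rewrite M42_ix.
by rewrite (toeplitz_commutator (fun x => hsum (fun s => t x (- s%:Z)) l)) K11E.
Qed.

Lemma A1T : A1 *m T - T *m A1 = iC *: (compM11 *m M21 + M31 *m M41).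
Proof.
rewrite -[X in _ - T *m X](subrK (adjmx A1)) A1_adj mulmxDr opprD addrCA A1T_adj /compM11.
rewrite mulmxBl -scalemxAr !mulmxA; mx_ring.
Qed.

Lemma A2T : A2 *m T - T *m A2 = iC *: (compM12 *m M22 + M32 *m M42).
Proof.
rewrite -[X in _ - T *m X](subrK (adjmx A2)) A2_adj mulmxDr opprD addrCA A2T_adj /compM12.
rewrite mulmxBl -scalemxAr !mulmxA; mx_ring.
Qed.

Lemma A2M41 : A2s R m *m M41 - M41 *m A2
  = iC *: (compK12 *m M22 + const_mx 1 *m corner_row).
Proof.
rewrite -[X in _ - M41 *m X](subrK (adjmx A2)) A2_adj mulmxDr opprD addrCA A2M41_adj /compK12.
rewrite mulmxBl -scalemxAr !mulmxA; mx_ring.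
Qed.

Lemma A1M42 : A1s R n *m M42 - M42 *m A1
  = iC *: (compK11 *m M21 + const_mx 1 *m corner_row).
Proof.
rewrite -[X in _ - M42 *m X](subrK (adjmx A1)) A1_adj mulmxDr opprD addrCA A1M42_adj /compK11.
rewrite mulmxBl -scalemxAr !mulmxA; mx_ring.
Qed.

(** [A2M41] transposed and reversed; [compM11E] and [compK11E] identify the result. *)
Lemma A2compM11 : A2 *m compM11 - compM11 *m A2s R m
  = iC *: (M32 *m compK11 + flip (n * m) *m corner_row^T *m (const_mx 1)^T).
Proof.
rewrite compM11E compK11E mulmxN mulNmx opprK.
have := congr1 (fun X => flip (n * m) *m X^T *m flip m) A2M41.
have tB p q (X Y : 'M[C]_(p, q)) : (X - Y)^T = X^T - Y^T by rewrite linearB.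
have tZD p q (X Y : 'M[C]_(p, q)) x : (x *: (X + Y))^T = x *: (X^T + Y^T).
  by rewrite linearZ linearD.
rewrite tB tZD !trmx_mul (flip_swap (@flip_A2s R m)) (flip_swap (@flip_A2 R n m)) tr_M22.
rewrite mulmxBr mulmxBl -scalemxAr -scalemxAl mulmxDr mulmxDl !mulmxA flipK mul1mx.
rewrite -[_ *m flip m *m flip m]mulmxA flipK mulmx1 flip_M32 trmx_const.
rewrite -[_ *m const_mx 1 *m flip m]mulmxA const_flip => <-.
by rewrite addrC.
Qed.

End Displacements.

(** * Reversal and the relation between g12 and g21 *)

Section SymplecticFlip.
Variable F : fieldType.

(** The skew-symmetric product J U; see [sflipE]. *)
Definition sflip p : 'M[F]_(p + p) := block_mx 0 (flip F p) (- flip F p) 0.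

Lemma flip_inv p (A : 'M[F]_p) : A \in unitmx ->
  flip F p *m A^T *m flip F p = A -> flip F p *m (invmx A)^T *m flip F p = invmx A.
Proof.
move=> uA e; apply: (can_inj (mulKmx uA)); rewrite mulmxV // -{1}e !mulmxA.
rewrite -[_ *m flip F p *m flip F p]mulmxA flipK mulmx1.
by rewrite -[_ *m A^T *m _]mulmxA trmx_inv mulmxV ?unitmx_tr // mulmx1 flipK.
Qed.

Lemma flip_inv_shift p (A : 'M[F]_p) l : flip F p *m A^T *m flip F p = A ->
  A - l%:M \in unitmx ->
  flip F p *m (invmx (A - l%:M))^T *m flip F p = invmx (A - l%:M).
Proof.
move=> e uA; apply: flip_inv => //.
rewrite linearB /= tr_scalar_mx mulmxBr mulmxBl e; congr (_ - _).
by rewrite mul_mx_scalar -scalemxAl flipK scalemx1.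
Qed.

(** Persymmetry passes from [T] to its inverse. Reversal and transposition swap the left and right
    outer factors of the two blocks, and the signs in [sflip] match those in the hypotheses on [L1]
    and [N1]. *)
Lemma sflip_disp p q N i (T : 'M[F]_N) L1 L2 L3 L4 N1 N2 N3 N4 K1 (K2 : 'M_(p, q)) :
  flip F N *m T^T *m flip F N = T -> T \in unitmx ->
  L2^T = L3 -> N2^T = N3 ->
  flip F N *m L3 = L3 *m flip F p -> flip F N *m N3 = N3 *m flip F q ->
  L1 = - (flip F N *m L4^T *m flip F p) -> N1 = - (flip F N *m N4^T *m flip F q) ->
  K1 = flip F q *m K2^T *m flip F p ->
  disp21 i T L1 L3 N2 N4 K1 = sflip q *m (disp12 i T L2 L4 N1 N3 K2)^T *m sflip p.
Proof.
move=> fT uT eL eN fL fN eL1 eN1 eK.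
have fR := flip_inv uT fT.
have eNN : col_mx N2 N4 *m flip F N = sflip q *m (row_mx N1 N3)^T.
  rewrite tr_row_mx mul_block_col !mul0mx addr0 add0r mul_col_mx -eN trmxK eN1.
  rewrite linearN /= !trmx_mul !flip_tr trmxK mulmxN mulNmx opprK !mulmxA flipK mul1mx.
  congr col_mx; apply: trmx_inj; by rewrite !trmx_mul !flip_tr eN.
have eLL : row_mx L1 L3 = flip F N *m (col_mx L2 L4)^T *m sflip p.
  rewrite tr_col_mx -mulmxA mul_row_block !mulmx0 addr0 add0r mul_mx_row eL1 eL.
  rewrite mulmxN mulmxN mulmxA [flip F N *m (L3 *m _)]mulmxA fL. by rewrite -[L3 *m _ *m _]mulmxA flipK mulmx1.
have tZB a b (X Y : 'M[F]_(a, b)) x : (x *: (X - Y))^T = x *: (X^T - Y^T).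
  by rewrite linearZ linearB.
rewrite /disp21 /disp12 tZB -scalemxAr -scalemxAl mulmxBr mulmxBl.
congr (_ *: (_ - _)).
  have RU : invmx T *m flip F N = flip F N *m (invmx T)^T.
    by rewrite -{1}fR -!mulmxA flipK mulmx1.
  by rewrite !trmx_mul !mulmxA -eNN eLL !mulmxA -[_ *m invmx T *m _]mulmxA RU !mulmxA.
rewrite tr_block_mx !mulmx_block !trmx0 !(mul0mx, mulmx0) ?(add0r, addr0).
by rewrite eK !mul0mx !mulNmx mulmxN opprK.
Qed.
End SymplecticFlip.

Section Rational.
Variable R : realType.
Local Notation C := (R[i]).
Local Notation iC := (iC R).
Variables n m : nat.
Variable t : int -> int -> C.
Local Notation A1 := (A1 R n m).
Local Notation A2 := (A2 R n m).
Local Notation M21 := (M21 R n m).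
Local Notation M31 := (M31 R n m).
Local Notation M22 := (M22 R n m).
Local Notation M32 := (M32 R n m).
Local Notation T := (TBT n m t).
Local Notation M11 := (M11 n m t).
Local Notation M41 := (M41 n m t).
Local Notation M12 := (M12 n m t).
Local Notation M42 := (M42 n m t).
Local Notation K11 := (K11 n m t).
Local Notation K12 := (K12 n m t).
Local Notation flip := (flip C).
Local Notation compM11 := (compM11 n m t).
Local Notation compM12 := (compM12 n m t).
Local Notation compK11 := (compK11 n m t).
Local Notation compK12 := (compK12 n m t).
Local Notation r := (corner_row n m t).
Hypothesis uT : T \in unitmx.

(** Passing from [M12] to [compM12] changes [Pi2] by [T *m M32]. The inverse of [T] cancels there,
    and what remains removes the block of ones, which is [M21 *m M32], and turns [K12] into
    [compK12]. *)
Lemma g12E : g12 n m t = disp12 iC T M21 M41 compM12 M32 compK12.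
Proof.
rewrite /g12 /disp12 -scalerBr; congr (_ *: _).
have -> : Pi2 n m t = row_mx compM12 M32 + row_mx (T *m M32) 0.
  by rewrite /Pi2 add_row_mx addr0 /compM12 subrK.
rewrite mulmxDr -addrA; congr (_ + _).
rewrite mul_mx_row mulmx0 mulmxA mulmxKV // mul_col_mx M21M32.
rewrite !block_mxEh !opp_row_mx !opp_col_mx add_row_mx add_col_mx.
by rewrite add0r subrr opprB oppr0.
Qed.

Lemma g21E : g21 n m t = disp21 iC T compM11 M31 M22 M42 compK11.
Proof.
rewrite /g21 /disp21 -scalerBr; congr (_ *: _).
have -> : Pi1 n m t = row_mx compM11 M31 + row_mx (T *m M31) 0.
  by rewrite /Pi1 add_row_mx addr0 /compM11 subrK.
rewrite mulmxDr -addrA; congr (_ + _).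
rewrite mul_mx_row mulmx0 mulmxA mulmxKV // mul_col_mx M22M31.
rewrite !block_mxEh !opp_row_mx !opp_col_mx add_row_mx add_col_mx.
by rewrite add0r subrr opprB oppr0.
Qed.

Lemma sflipE p : Jmx R p *m Umx R p = sflip C p.
Proof.
rewrite UmxE /Jmx mulmx_block !(mul0mx, mulmx0, mul1mx, mulmx1, addr0, add0r).
by rewrite mulNmx mul1mx.
Qed.

Lemma sflipNE p : Umx R p *m Jmx R p = - sflip C p.
Proof.
rewrite UmxE /Jmx mulmx_block !(mul0mx, mulmx0, mul1mx, mulmx1, addr0, add0r).
by rewrite mulmxN mulmx1 opp_block_mx !oppr0 opprK.
Qed.

Lemma g21_from_g12 :
  g21 n m t = - (Umx R n *m Jmx R n *m (g12 n m t)^T *m Jmx R m *m Umx R m).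
Proof.
rewrite g21E (@sflip_disp _ _ _ _ _ _ _ M21 _ M41 compM12 _ M32 _ _ compK12) ?g12E.
- by rewrite -[_ *m Jmx R m *m Umx R m]mulmxA sflipE sflipNE !mulNmx opprK.
- exact: flip_T.
- exact: uT.
- exact: tr_M21.
- exact: tr_M22.
- exact: flip_M31.
- exact: flip_M32.
- exact: compM11E.
- exact: compM12E.
- exact: compK11E.
Qed.

Lemma shift_comm p q (A : 'M[C]_p) (B : 'M_q) X l :
  (A - l%:M) *m X - X *m (B - l%:M) = A *m X - X *m B.
Proof. by rewrite mulmxBl mulmxBr mul_scalar_mx mul_mx_scalar; mx_ring. Qed.

Lemma shift_eq p q (A : 'M[C]_p) (B : 'M_q) X l :
  A *m X = X *m B -> (A - l%:M) *m X = X *m (B - l%:M).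
Proof. by move=> e; apply/eqP; rewrite -subr_eq0 shift_comm e subrr. Qed.

Lemma shift_comm2 p (A B : 'M[C]_p) l k :
  A *m B = B *m A -> (A - l%:M) *m (B - k%:M) = (B - k%:M) *m (A - l%:M).
Proof. by move=> e; apply: shift_eq; apply/esym/shift_eq. Qed.

End Rational.

(** * Spectra of the triangular shift matrices *)

Section Pencil.
Variable R : realType.
Local Notation C := (R[i]).
Local Notation iC := (iC R).
Variables n m : nat.
Local Notation A1 := (A1 R n m).
Local Notation A2 := (A2 R n m).
Local Notation ix i j := (@mxtens_index n m (i, j)).
(** The diagonal entry i/2, the only eigenvalue of the shift matrices. *)
Definition hC : C := halfC R * iC.

Lemma aa_lt (i k : nat) : (i < k)%N -> aa R (zd i k) = 0.
Proof. by move=> h; rewrite aaE ltnNge (ltnW h) /= gtn_eqF ?mulr0. Qed.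

Lemma det_toeplitz_lower p (A : 'M[C]_p) l : (forall i j : 'I_p, A i j = aa R (zd i j)) ->
  \det (A - l%:M) = (hC - l) ^+ p.
Proof.
move=> eA; rewrite det_trig.
  under eq_bigr do rewrite !mx_linE mxE eqxx eA /zd subrr mulr1n.
  by rewrite prodr_const card_ord.
apply/is_trig_mxP => i j ij; rewrite !mx_linE mxE eA aa_lt // lt_eqF //.
by rewrite oppr0 addr0.
Qed.

(** The case p = 0 appears because an empty matrix is always invertible. *)
Lemma A1s_unit p l : (A1s R p - l%:M \in unitmx) = (p == 0)%N || (l != hC).
Proof.
rewrite unitmxE (det_toeplitz_lower (A := A1s R p)) => [|i j]; last by rewrite mxE.
by rewrite unitfE expf_eq0 negb_and subr_eq0 eq_sym lt0n negbK.
Qed.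

Lemma A2s_unit p l : (A2s R p - l%:M \in unitmx) = (p == 0)%N || (l != hC).
Proof.
rewrite unitmxE (det_toeplitz_lower (A := A2s R p)) => [|i j]; last by rewrite mxE.
by rewrite unitfE expf_eq0 negb_and subr_eq0 eq_sym lt0n negbK.
Qed.

Lemma A1_unit l : (A1 - l%:M \in unitmx) = (n * m == 0)%N || (l != hC).
Proof.
rewrite unitmxE det_trig.
  under eq_bigr do rewrite !mx_linE mxE [_%:M _ _]mxE !eqxx /zd subrr mulr1n.
  rewrite prodr_const card_ord /aa /=.
  by rewrite unitfE expf_eq0 negb_and subr_eq0 eq_sym lt0n negbK.
apply/is_trig_mxP => I K; case: (mxtens_indexP I) => i j; case: (mxtens_indexP K) => k l'.
rewrite !mx_linE !mxE !idxE => lt; rewrite -val_eqE (ltn_eqF lt) mulr0n oppr0 addr0.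
case: ifP => // /eqP jl; rewrite aa_lt //.
by move: lt; rewrite /= jl ltn_add2r ltn_mul2r => /andP[].
Qed.

Lemma A2_unit l : (A2 - l%:M \in unitmx) = (n * m == 0)%N || (l != hC).
Proof.
rewrite unitmxE det_trig.
  under eq_bigr do rewrite !mx_linE mxE [_%:M _ _]mxE !eqxx /zd subrr mulr1n.
  rewrite prodr_const card_ord /aa /=.
  by rewrite unitfE expf_eq0 negb_and subr_eq0 eq_sym lt0n negbK.
apply/is_trig_mxP => I K; case: (mxtens_indexP I) => i j; case: (mxtens_indexP K) => k l'.
rewrite !mx_linE !mxE !idxE => lt; rewrite -val_eqE (ltn_eqF lt) mulr0n oppr0 addr0.
case: ifP => // /eqP jl; rewrite aa_lt //.
by move: lt; rewrite /= jl ltn_add2l.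
Qed.

End Pencil.

(** * Resolvents and the determinant of G *)

Section Resolvent.
Variable R : realType.
Local Notation C := (R[i]).
Local Notation iC := (iC R).
Local Notation hC := (hC R).

Lemma hC_add : hC + hC = iC.
Proof. by rewrite -mulrDl halfC_add mul1r. Qed.

(** The entries of the resolvent applied to the vector of ones. Subtracting consecutive equations of
    the lower triangular system gives a geometric progression. *)
Definition resv (l : C) k : C := - (l - hC)^-1 * ((l + hC) / (l - hC)) ^+ k.

Lemma sum_resv l k : l != hC ->
  iC * \sum_(0 <= s < k) resv l s = 1 - ((l + hC) / (l - hC)) ^+ k.
Proof.
move=> lh; have lh' : l - hC != 0 by rewrite subr_eq0.
elim: k => [|k IH]; first by rewrite big_geq // mulr0 expr0 subrr.
rewrite big_nat_recr //= mulrDr IH exprSr /resv -hC_add.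
set q := _ ^+ k; field.
by [].
Qed.

Lemma resv_eq p l (i : 'I_p) : l != hC ->
  \sum_(k < p) aa R (zd i k) * resv l k - l * resv l i = 1.
Proof.
move=> lh; have lh' : l - hC != 0 by rewrite subr_eq0.
transitivity (iC * (halfC R * resv l i + \sum_(0 <= k < i) resv l k) - l * resv l i).
  congr (_ - _); rewrite -(sum_weight i) mulr_sumr.
  by apply: eq_bigr => k _; rewrite aaE mulrA.
rewrite mulrDr sum_resv // mulrA [iC * _]mulrC -/hC /resv.
by field.
Qed.

Lemma invmx_A1s p l : l != hC ->
  invmx (A1s R p - l%:M) *m const_mx 1 = \col_i resv l i :> 'cV_p.
Proof.
move=> lh; have uA : A1s R p - l%:M \in unitmx by rewrite A1s_unit lh orbT.
apply: (can_inj (mulKmx uA)); rewrite mulKVmx //.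
apply/matrixP => i j; rewrite mulmxBl mul_scalar_mx !mx_linE mxE [(_ *m _) i j]mxE.
rewrite [X in _ * X]mxE -(resv_eq i lh); congr (_ - _).
by apply: eq_bigr => k _; rewrite !mxE.
Qed.

Lemma invmx_A2s p l : l != hC ->
  invmx (A2s R p - l%:M) *m const_mx 1 = \col_i resv l i :> 'cV_p.
Proof. exact: invmx_A1s. Qed.

Lemma ones_invmx_A1s p l : l != hC ->
  ((const_mx 1 : 'rV_p) *m invmx (A1s R p - l%:M) *m (const_mx 1 : 'cV_p)) 0 0
  = - iC * (1 - ((l + hC) / (l - hC)) ^+ p).
Proof.
move=> lh; rewrite -mulmxA invmx_A1s // mxE -sum_resv // mulrA mulNr iCiC opprK mul1r.
by rewrite big_mkord; apply: eq_bigr => k _; rewrite !mxE mul1r.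
Qed.

Variables n m : nat.
Local Notation A1 := (A1 R n m).
Local Notation A2 := (A2 R n m).
Local Notation ix i j := (@mxtens_index n m (i, j)).

Lemma invmx_A1_M32 l : l != hC -> invmx (A1 - l%:M) *m M32 R n m = M32 R n m *m invmx (A1s R n - l%:M).
Proof.
by move=> lh; apply: commmx_inv; rewrite ?A1_unit ?A1s_unit ?lh ?orbT //; apply: shift_eq; exact: A1M32.
Qed.

Lemma invmx_A2_M31 l : l != hC -> invmx (A2 - l%:M) *m M31 R n m = M31 R n m *m invmx (A2s R m - l%:M).
Proof.
by move=> lh; apply: commmx_inv; rewrite ?A2_unit ?A2s_unit ?lh ?orbT //; apply: shift_eq; exact: A2M31.
Qed.

(** The two resolvents act on different indices, so the vector is a tensor product of two geometric
    progressions. *)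
Lemma resolvent_ones l1 l2 i j : l1 != hC -> l2 != hC ->
  (invmx (A1 - l1%:M) *m invmx (A2 - l2%:M) *m const_mx 1 : 'cV_(n * m)) (ix i j) 0
  = resv l1 i * resv l2 j.
Proof.
move=> lh1 lh2; have uA : A1 - l1%:M \in unitmx by rewrite A1_unit lh1 orbT.
rewrite -mulmxA -(M31_ones R n m) [invmx (A2 - _) *m _]mulmxA invmx_A2_M31 //.
rewrite -[M31 R n m *m _ *m _]mulmxA invmx_A2s //.
pose y : 'cV[C]_(n * m) := \col_I (resv l1 (blk I) * resv l2 (inn I)).
suff -> : invmx (A1 - l1%:M) *m (M31 R n m *m \col_i resv l2 i) = y by rewrite mxE !idxE.
apply: (can_inj (mulKmx uA)); rewrite mulKVmx //.
apply: mx_ixP => a b c; rewrite mulmxBl mul_scalar_mx !mx_linE mul_M31_mx mul_A1 !mxE !idxE.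
rewrite -[LHS]mul1r -(resv_eq a lh1) mulrBl mulr_suml -[l1 * _ * _]mulrA; congr (_ - _).
by apply: eq_bigr => k _; rewrite mxE !idxE mulrA.
Qed.

Variable t : int -> int -> C.
Local Notation T := (TBT n m t).
Hypothesis uT : T \in unitmx.

(** The scalar [f] of [det_rank1] and [dispG_solve] for the present data. *)
Definition gfactor l1 l2 : C :=
  1 + (corner_row n m t *m invmx T
       *m (invmx (A1 - l1%:M) *m invmx (A2 - l2%:M)) *m (const_mx 1 : 'cV_(n * m))) 0 0.

(** Transposition followed by conjugation with the reversal fixes [T], [Y] and the vector of ones
    and exchanges the two rank one terms; the reversal has determinant of square 1. *)
Lemma gfactor_flip l1 l2 : l1 != hC -> l2 != hC ->
  let Y := invmx (A1 - l1%:M) *m invmx (A2 - l2%:M) in let b : 'cV_(n * m) := const_mx 1 in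
  \det (T + (flip C (n * m) *m (corner_row n m t)^T) *m b^T *m Y)
  = \det (T + Y *m b *m corner_row n m t).
Proof.
move=> lh1 lh2 Y b; set U := flip C (n * m).
have uA1 : A1 - l1%:M \in unitmx by rewrite A1_unit lh1 orbT.
have uA2 : A2 - l2%:M \in unitmx by rewrite A2_unit lh2 orbT.
have fA1 := flip_inv_shift (@flip_A1 R n m) uA1.
have fA2 := flip_inv_shift (@flip_A2 R n m) uA2.
have c12 : invmx (A1 - l1%:M) *m invmx (A2 - l2%:M) = invmx (A2 - l2%:M) *m invmx (A1 - l1%:M).
  apply: (commmx_inv uA1 uA1); rewrite (commmx_inv uA2 uA2) //.
  exact/shift_comm2/esym/A12.
have fY : U *m Y^T *m U = Y.
  rewrite /Y {1}c12 trmx_mul -{2}fA1 -{2}fA2 !mulmxA.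
  by rewrite -[_ *m U *m U]mulmxA flipK mulmx1.
clearbody Y.
have dU : \det U * \det U = 1 by rewrite -det_mulmx flipK det1.
rewrite -det_tr -[LHS]mul1r -dU mulrAC -!det_mulmx; congr (\det _).
rewrite linearD /= mulmxDr mulmxDl flip_T; congr (_ + _).
rewrite !trmx_mul !trmxK flip_tr -{2}fY !mulmxA.
by rewrite -[_ *m U *m b]mulmxA flip_const -[_ *m U *m U]mulmxA flipK mulmx1.
Qed.

Lemma Gmx_hu l1 l2 : l1 != hC -> l2 != hC ->
  Gmx n m t l1 l2 *m hu n m t l1 l2 = (iC * gfactor l1 l2) *: ecol R n m.
Proof.
move=> lh1 lh2; rewrite /Gmx (g12E uT) (g21E uT) /hu /hGam /hGam1 /hGam2 -mul_col_mx.
apply: dispG_solve; rewrite ?A1_unit ?A2_unit ?A1s_unit ?A2s_unit ?lh1 ?lh2 ?orbT //.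
- exact: iCiC.
- exact: shift_comm2 (@A12 R n m).
- exact/shift_eq/A2M31.
- exact/esym/shift_eq/esym/M21A2.
- exact/shift_eq/A1M32.
- exact/esym/shift_eq/esym/M22A1.
- by rewrite shift_comm A1T.
- by rewrite shift_comm A2T.
- by rewrite shift_comm A2M41.
- by rewrite shift_comm A1M42.
- exact: M31_ones.
- exact: M32_ones.
Qed.

Lemma det_Gmx l1 l2 : l1 != hC -> l2 != hC ->
  \det (Gmx n m t l1 l2) = ((hC - l2) ^+ m * (hC - l1) ^+ n * gfactor l1 l2) ^+ 2.
Proof.
move=> lh1 lh2; have dT : \det T != 0 by rewrite -unitfE -unitmxE.
rewrite /Gmx (g12E uT) (g21E uT).
have ua : A2s R m - l2%:M \in unitmx by rewrite A2s_unit lh2 orbT.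
have uc : A1s R n - l1%:M \in unitmx by rewrite A1s_unit lh1 orbT.
have uA1 : A1 - l1%:M \in unitmx by rewrite A1_unit lh1 orbT.
have uA2 : A2 - l2%:M \in unitmx by rewrite A2_unit lh2 orbT.
have A2L1 : (A2 - l2%:M) *m compM11 n m t - compM11 n m t *m (A2s R m - l2%:M) = iC *: (M32 R n m *m compK11 n m t
   + flip C (n * m) *m (corner_row n m t)^T *m (const_mx 1)^T) by rewrite shift_comm A2compM11.
have A1T' := A1T n m t; rewrite -(shift_comm _ _ _ l1) in A1T'.
have A2T' := A2T n m t; rewrite -(shift_comm _ _ _ l2) in A2T'.
have A2M41' := A2M41 n m t; rewrite -(shift_comm _ _ _ l2) in A2M41'.
have A1M42' := A1M42 n m t; rewrite -(shift_comm _ _ _ l1) in A1M42'.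
have e := det_dispG (iCiC R) uT uA1 uA2 ua uc (shift_comm2 _ _ (@A12 R n m))
  (shift_eq _ (A2M31 R n m)) (esym (shift_eq _ (esym (M21A2 R n m))))
  (shift_eq _ (A1M32 R n m)) (esym (shift_eq _ (esym (M22A1 R n m))))
  A1T' A2T' A2M41' A1M42' A2L1 (M31_ones R n m) (M32_ones R n m).
rewrite e; last by rewrite !trmx_const M21_ones.
rewrite gfactor_flip // det_rank1 // (det_toeplitz_lower (A := A2s R m)); last first.
  by move=> i j; rewrite mxE.
rewrite (det_toeplitz_lower (A := A1s R n)); last by move=> i j; rewrite mxE.
by rewrite -/(gfactor l1 l2); field.
Qed.
End Resolvent.

(** * The polynomial theta *)

(** In characteristic zero the integers already provide more roots than the degree allows. *)
Lemma poly_eq0_horner (F : numFieldType) (p : {poly F}) : (forall x, p.[x] = 0) -> p = 0.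
Proof.
move=> p0; apply/eqP; apply: contraT => pn0.
have := max_poly_roots (rs := [seq k%:R | k <- iota 0 (size p)]) pn0.
rewrite size_map size_iota ltnn => -> //.
  by apply/allP => x _; rewrite rootE p0.
by rewrite map_inj_uniq ?iota_uniq // => a b /eqP; rewrite eqr_nat => /eqP.
Qed.

Section Theta.
Variable R : realType.
Local Notation C := (R[i]).
Local Notation iC := (iC R).
Local Notation hC := (hC R).

Lemma eval2E (p : {poly {poly C}}) l1 l2 :
  eval2 p l1 l2 = horner_eval l1 (horner_eval l2%:P p).
Proof. by []. Qed.

Lemma eval2_eq0 (p : {poly {poly C}}) : (forall l1 l2, eval2 p l1 l2 = 0) -> p = 0.
Proof.
move=> p0; have q0 l2 : p.[l2%:P] = 0 by apply: poly_eq0_horner => l1; exact: p0.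
apply/eqP; apply: contraT => pn0.
have := max_poly_roots (rs := [seq (k%:R)%:P : {poly C} | k <- iota 0 (size p)]) pn0.
rewrite size_map size_iota ltnn => -> //.
  by apply/allP => x /mapP[k _ ->]; rewrite rootE q0.
by rewrite map_inj_uniq ?iota_uniq // => a b /polyC_inj /eqP; rewrite eqr_nat => /eqP.
Qed.

(** Multiplying p - q by the equations of the two excluded lines gives a polynomial vanishing
    everywhere, and bivariate polynomials form a domain. *)
Lemma eval2_eq (p q : {poly {poly C}}) l1 l2 :
  (forall x y, x != l1 -> y != l2 -> eval2 p x y = eval2 q x y) -> p = q.
Proof.
move=> pq; pose a : {poly {poly C}} := ('X - l1%:P)%:P; pose b : {poly {poly C}} := 'X - l2%:P%:P.
have : (p - q) * (a * b) = 0.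
  apply: eval2_eq0 => x y.
  have -> : eval2 ((p - q) * (a * b)) x y = (eval2 p x y - eval2 q x y) * ((x - l1) * (y - l2)).
    by rewrite /eval2 /a /b !(hornerM, hornerXsubC, hornerC, hornerD, hornerN).
  case: (eqVneq x l1) => [->|xl]; first by rewrite subrr mul0r mulr0.
  case: (eqVneq y l2) => [->|yl]; first by rewrite subrr !mulr0.
  by rewrite pq // subrr mul0r.
move/eqP; rewrite !mulf_eq0 polyC_eq0 !polyXsubC_eq0 !orbF subr_eq0 => /eqP //.
Qed.

Variables (n m : nat) (t : int -> int -> C).
Hypotheses (n0 : (0 < n)%N) (m0 : (0 < m)%N).
Local Notation T := (TBT n m t).
Hypothesis uT : T \in unitmx.

Lemma det_Gmx_poly : exists D : {poly {poly C}}, forall l1 l2, eval2 D l1 l2 = \det (Gmx n m t l1 l2).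
Proof.
pose cst p q (X : 'M[C]_(p, q)) : 'M[{poly {poly C}}]_(p, q) := map_mx (polyC \o polyC) X.
pose c := cst _ _ (A1s R n) - ('X%:P)%:M; pose a := cst _ _ (A2s R m) - 'X%:M.
pose G := block_mx (block_mx a 0 0 a) (cst _ _ (g12 n m t)) (cst _ _ (g21 n m t)) (block_mx c 0 0 c).
exists (\det G) => l1 l2; rewrite eval2E -!det_map_mx; congr (\det _).
have ecst p q (X : 'M[C]_(p, q)) : map_mx (horner_eval l1) (map_mx (horner_eval l2%:P) (cst _ _ X)) = X.
  by apply/matrixP => i j; rewrite !mxE /= /horner_eval !hornerC.
rewrite !map_block_mx !map_mx0 !ecst !map_mxB !ecst !map_scalar_mx /= /horner_eval.
by rewrite !hornerC !hornerX hornerC.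
Qed.

(** The entry [resv] with its denominator cleared by the k-th power of X - i/2, up to sign. *)
Definition resp k i : {poly C} := ('X + hC%:P) ^+ i * ('X - hC%:P) ^+ (k.-1 - i).

Lemma resp_eval k (i : 'I_k) l : l != hC ->
  (resp k i).[l] = - ((l - hC) ^+ k * resv l i).
Proof.
move=> lh; have lh' : l - hC != 0 by rewrite subr_eq0.
rewrite /resp /resv hornerM !horner_exp hornerXsubC hornerD hornerX hornerC.
have -> : (l - hC) ^+ k = (l - hC) ^+ (k.-1 - i) * ((l - hC) ^+ i * (l - hC)).
  by rewrite -exprSr -exprD; congr (_ ^+ _); have := ltn_ord i; lia.
have ci : (l - hC) ^+ i != 0 by rewrite expf_neq0.
by rewrite expr_div_n; move: (_ ^+ i) ci (_ ^+ i) (_ ^+ (_ - _)) => c c0 a b; field; rewrite c0 lh'.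
Qed.

Lemma size_resp k (i : 'I_k) : size (resp k i) = k.
Proof.
have e : 'X + hC%:P = 'X - (- hC)%:P by rewrite polyCN opprK.
rewrite /resp e size_Mmonic ?monic_neq0 ?monic_exp ?monicXsubC //.
by rewrite !size_exp_XsubC; have := ltn_ord i; lia.
Qed.

(** The function - (l1 - i/2)^n (l2 - i/2)^m f with denominators cleared. The minus signs in the two
    factors [resp] cancel. *)
Definition theta0 : {poly {poly C}} :=
  - ((('X - hC%:P) ^+ n)%:P * (map_poly polyC (('X - hC%:P) ^+ m))
     + \sum_I ((corner_row n m t *m invmx T) 0 I *: resp n (blk I))%:P
               * map_poly polyC (resp m (inn I))).

Lemma theta0_eval l1 l2 : l1 != hC -> l2 != hC ->
  eval2 theta0 l1 l2 = - ((l1 - hC) ^+ n * (l2 - hC) ^+ m * gfactor n m t l1 l2).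
Proof.
move=> lh1 lh2.
have ep (a b : {poly C}) : eval2 (a%:P * map_poly polyC b) l1 l2 = a.[l1] * b.[l2].
  by rewrite /eval2 hornerM hornerC hornerM horner_map hornerC.
have eval2N q : eval2 (- q) l1 l2 = - eval2 q l1 l2 by rewrite /eval2 !hornerN.
have eval2D q q' : eval2 (q + q') l1 l2 = eval2 q l1 l2 + eval2 q' l1 l2.
  by rewrite /eval2 !hornerD.
rewrite eval2N eval2D ep !horner_exp !hornerXsubC /gfactor mulrDr mulr1; congr (- (_ + _)).
rewrite /eval2 !horner_sum -mulmxA mxE mulr_sumr; apply: eq_bigr => I _.
rewrite -[LHS]/(eval2 _ _ _) ep hornerZ; case: (mxtens_indexP I) => i j.
rewrite resolvent_ones // !idxE !resp_eval //; ring.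
Qed.

(** The polynomials [resp] have degree one less than their first argument, so only the product of
    the two powers reaches the top coefficient. *)
Lemma theta0_coef : (theta0`_m)`_n = -1.
Proof.
have coefp (a b : {poly C}) : ((a%:P * map_poly polyC b)`_m)`_n = a`_n * b`_m.
  by rewrite coefCM coef_map /= mulrC coefCM mulrC.
have cX k : (('X - hC%:P) ^+ k)`_k = 1 :> C.
  have := monicP (monic_exp k (monicXsubC hC)).
  by rewrite lead_coefE size_exp_XsubC.
rewrite /theta0 !coefN coefD coefD coefp !cX mulr1 !coef_sum big1 ?addr0 // => I _.
by rewrite coefp; case: (mxtens_indexP I) => i j; rewrite !idxE [(resp m j)`_m]nth_default ?size_resp // mulr0.
Qed.

(** [det_Gmx] gives the square away from the lines through i/2. As the determinant is itself a
    polynomial, [eval2_eq] extends the identity to these lines. *)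
Lemma theta0_branch : theta_branch n m t theta0.
Proof.
split; last exact: theta0_coef.
have [D eD] := det_Gmx_poly.
have eval2X q l1 l2 : eval2 (q ^+ 2) l1 l2 = eval2 q l1 l2 ^+ 2 by rewrite /eval2 !horner_exp.
have sD : theta0 ^+ 2 = D.
  apply: (@eval2_eq _ _ hC hC) => x y xh yh; rewrite eval2X theta0_eval // eD det_Gmx //.
  rewrite sqrrN !exprMn -!exprM ![(_ * 2)%N]mulnC !exprM.
  by rewrite -[(hC - x) ^+ 2]sqrrN -[(hC - y) ^+ 2]sqrrN !opprB; ring.
by move=> l1 l2; rewrite -eval2X sD eD.
Qed.

(** Two branches have equal squares in a domain, hence agree up to sign, and the normalised
    coefficient -1 fixes the sign. *)
Lemma theta_branch_unique th : theta_branch n m t th -> th = theta0.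
Proof.
case=> sq c; have [sq0 c0] := theta0_branch.
have e : th ^+ 2 = theta0 ^+ 2.
  by apply: (@eval2_eq _ _ 0 0) => x y _ _; rewrite /eval2 !horner_exp; rewrite [LHS]sq [RHS]sq0.
move/eqP: e; rewrite eqf_sqr => /orP[] /eqP // e.
have cN (q : {poly {poly C}}) : ((- q)`_m)`_n = - (q`_m)`_n by rewrite !coefN.
move: c; rewrite e cN c0 opprK => /eqP.
by rewrite -addr_eq0 -[1 + 1]/(2%:R) pnatr_eq0.
Qed.

End Theta.

(** * The formulas for omega and u *)

Section TransferHalf.
Variables (F : fieldType) (N k : nat) (i : F) (T : 'M[F]_N).
Hypotheses (ii : i * i = -1) (uT : T \in unitmx).
Variables (M1 M3 : 'M[F]_(N, k)) (M2 M4 : 'M[F]_(k, N)).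
Variables (x : 'rV[F]_N) (y : 'cV[F]_N) (v : 'rV[F]_k) (w : 'cV[F]_k).
Let hu := col_mx M2 M4 *m invmx T *m y + i *: col_mx 0 w.
Let u := x *m (invmx T *m row_mx M1 M3) - i *: row_mx v 0.

(** The displacement equation, multiplied by the inverse of [T] on both sides, is sandwiched between
    [x] and [y]. The hypotheses on [x] and [y] turn the resolvents into boundary terms, which the
    corrections by [v] and [w] in [u] and [hu] cancel. *)
Lemma omega_half (A A' : 'M[F]_N) l mu :
  A *m T - T *m A' = i *: (M1 *m M2 + M3 *m M4) ->
  x *m (A' - mu%:M) = v *m M2 -> (A - l%:M) *m y = M3 *m w -> l != mu ->
  (x *m invmx T *m y) 0 0 = i * (l - mu)^-1 * (u *m hu) 0 0.
Proof.
set S := invmx T => e ex ey lmu.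
have uhu : i *: (u *m hu) = (l - mu) *: (x *m S *m y).
  have eR : i *: (S *m row_mx M1 M3 *m (col_mx M2 M4 *m S)) = S *m A - A' *m S.
    rewrite -[S *m _ *m _]mulmxA [row_mx _ _ *m _]mulmxA mul_row_col scalemxAr scalemxAl.
    by rewrite -e mulmxBl mulmxBr -mulmxA mulmxV // mulmx1 -mulmxA mulKmx.
  have e1 : x *m (S *m A - A' *m S) *m y
    = x *m S *m M3 *m w - v *m M2 *m S *m y + (l - mu) *: (x *m S *m y).
    rewrite -[x *m S *m M3 *m w]mulmxA -ey -ex.
    rewrite !(mulmxBl, mulmxBr) !mulmxA mul_mx_scalar -scalemxAl mul_mx_scalar -!scalemxAl.
    mx_ring.
  have e2 : u *m hu = x *m (S *m row_mx M1 M3 *m (col_mx M2 M4 *m S)) *m y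
      + i *: (x *m S *m M3 *m w - v *m M2 *m S *m y).
    have t2 : x *m (S *m row_mx M1 M3) *m col_mx 0 w = x *m S *m M3 *m w.
      by rewrite -!mulmxA mul_row_col mulmx0 add0r.
    have t3 : row_mx v 0 *m (col_mx M2 M4 *m S *m y) = v *m M2 *m S *m y.
      by rewrite !mulmxA mul_row_col mul0mx addr0.
    have t4 : row_mx v 0 *m col_mx 0 w = 0 by rewrite mul_row_col mulmx0 mul0mx addr0.
    rewrite /u /hu -/S mulmxDr !mulmxBl -!scalemxAr -!scalemxAl t2 t3 t4 !mulmxA.
    mx_ring.
  rewrite e2 scalerDr scalerA ii scalemxAl scalemxAr eR e1; mx_ring.
have lm0 : l - mu != 0 by rewrite subr_eq0.
have := congr1 (fun X : 'M_1 => X 0 0) uhu; rewrite !mx_linE => e'.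
by rewrite mulrAC e' mulrAC mulfV // mul1r.
Qed.

(** Transposing [hu] and reversing yields [M1 - T *m M3] in place of [M1]. The extra term [x *m M3]
    and the correction by [w] combine, by the last hypothesis, into the correction by [v]. *)
Lemma u_half cc :
  flip F N *m T^T *m flip F N = T -> M2^T = M3 ->
  flip F N *m M3 = M3 *m flip F k -> M1 - T *m M3 = - (flip F N *m M4^T *m flip F k) ->
  x = cc *: (y^T *m flip F N) ->
  x *m M3 + (i * cc) *: (w^T *m flip F k) = i *: v ->
  u = cc *: (hu^T *m sflip F k).
Proof.
move=> fT eM fM eM1 ex ev.
have fR := flip_inv uT fT.
have SU : invmx T *m flip F N = flip F N *m (invmx T)^T.
  by rewrite -{1}fR -!mulmxA flipK mulmx1.
have -> : hu^T = y^T *m (invmx T)^T *m row_mx M3 M4^T + i *: row_mx 0 w^T.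
  by rewrite /hu linearD linearZ /= !trmx_mul !tr_col_mx trmx0 eM mulmxA.
have eX : (flip F N *m row_mx M3 M4^T) *m sflip F k = row_mx (M1 - T *m M3) M3.
  rewrite mul_mx_row fM eM1 mul_row_block !mulmx0 addr0 add0r mulmxN.
  by rewrite -[M3 *m _ *m _]mulmxA flipK mulmx1.
have eW : row_mx 0 w^T *m sflip F k = row_mx (- (w^T *m flip F k)) 0.
  by rewrite mul_row_block !mul0mx mulmx0 !add0r mulmxN.
have eY : y^T *m (invmx T)^T = y^T *m flip F N *m invmx T *m flip F N.
  by rewrite -!mulmxA SU [flip F N *m (flip F N *m _)]mulmxA flipK mul1mx.
rewrite mulmxDl -scalemxAl eW eY -!mulmxA [flip F N *m (row_mx _ _ *m _)]mulmxA eX.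
rewrite scalerDr !mulmxA -[y^T *m _ *m _ *m _]mulmxA scalemxAl -ex /u.
rewrite !mul_mx_row !mulmxBr [invmx T *m (T *m M3)]mulKmx //.
rewrite !scale_row_mx opp_row_mx !add_row_mx !scaler0 oppr0 !addr0; congr row_mx.
by rewrite -ev; mx_ring.
Qed.
End TransferHalf.

(** * Resolvents of the adjoint shift matrices *)

Section Adjoint.
Variable R : realType.
Local Notation C := (R[i]).
Local Notation iC := (iC R).
Local Notation hC := (hC R).

Lemma adjmxM p q r (X : 'M[C]_(p, q)) (Y : 'M_(q, r)) :
  adjmx (X *m Y) = adjmx Y *m adjmx X.
Proof. by rewrite /adjmx trmx_mul; exact: map_mxM. Qed.

Lemma adjmxK p q : cancel (@adjmx R p q) (@adjmx R q p).
Proof. by move=> X; apply/matrixP => i j; rewrite !adjmxE conjcK. Qed.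

Lemma adjmx_shift p (A : 'M[C]_p) mu : adjmx A - mu%:M = adjmx (A - (conjc mu)%:M).
Proof.
apply/matrixP => i j; rewrite !(mx_linE, adjmxE) mxE [_%:M j i]mxE eq_sym.
case: eqP => _; rewrite ?mulr1n ?mulr0n; last by rewrite !subr0.
by rewrite -[in LHS](conjcK mu); exact/esym/rmorphB.
Qed.

Lemma unitmx_adjmx p (A : 'M[C]_p) : (adjmx A \in unitmx) = (A \in unitmx).
Proof.
have e : \det (adjmx A) = conjc (\det A).
  by rewrite -[in RHS]det_tr; exact: (det_map_mx (@conjc R : {rmorphism C -> C})).
rewrite !unitmxE e.
by rewrite !unitfE; exact: (congr1 negb (fmorph_eq0 (@conjc R) _)).
Qed.

Lemma conj_hC : conjc hC = - hC.
Proof.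
have cM x y : conjc (x * y : C) = conjc x * conjc y by exact: rmorphM.
by rewrite /hC cM conj_halfC conj_iC mulrN.
Qed.

Lemma conjc_neq_hC (mu : C) : (conjc mu != hC) = (mu + hC != 0).
Proof. by rewrite addr_eq0 -conj_hC; congr negb; apply/eqP/eqP => [<-|->]; rewrite conjcK. Qed.

Lemma A1s_adj_unit p mu : mu + hC != 0 -> adjmx (A1s R p) - mu%:M \in unitmx.
Proof. by rewrite adjmx_shift unitmx_adjmx A1s_unit conjc_neq_hC orbC => ->. Qed.

(** The adjoint differs from [A1s] by i times the product of the column and the row of ones, so the
    row of ones times the resolvent is a left eigenvector up to the resolvent; [ones_invmx_A1s]
    evaluates the scalar. *)
Lemma ones_invmx_A1s_adj p mu : mu != hC -> mu + hC != 0 ->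
  (const_mx 1 : 'rV_p) *m invmx (adjmx (A1s R p) - mu%:M)
  = ((mu - hC) / (mu + hC)) ^+ p *: (const_mx 1 *m invmx (A1s R p - mu%:M)).
Proof.
move=> mh mh'; have uA : A1s R p - mu%:M \in unitmx by rewrite A1s_unit mh orbT.
apply: (can_inj (mulmxK (A1s_adj_unit p mh'))); rewrite mulmxKV ?A1s_adj_unit //.
have -> : adjmx (A1s R p) - mu%:M = A1s R p - mu%:M - iC *: (const_mx 1 *m (const_mx 1 : 'rV_p)).
  rewrite (_ : const_mx 1 *m _ = const_mx 1); last first.
    by apply/matrixP => i j; rewrite mxE big_ord1 !mxE mulr1.
  by rewrite -A1s_adj; mx_ring.
rewrite -scalemxAl mulmxBr mulmxKV // -scalemxAr mulmxA.
rewrite [X in X *m const_mx 1]mx11_scalar ones_invmx_A1s // mul_scalar_mx scalerA.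
have mh0 : mu - hC != 0 by rewrite subr_eq0.
have sub1 k (X : 'rV[C]_p) : X - k *: X = (1 - k) *: X by rewrite scalerBl scale1r.
rewrite mulrA mulrN iCiC opprK mul1r sub1 scalerA subKr -exprMn.
rewrite (_ : _ * _ = 1) ?expr1n ?scale1r //.
by field; rewrite mh0 mh'.
Qed.

Variables n m : nat.
Local Notation A1 := (A1 R n m).
Local Notation A2 := (A2 R n m).

Lemma M22A1_adj : M22 R n m *m adjmx A1 = adjmx (A1s R n) *m M22 R n m.
Proof.
have := congr1 (@adjmx R _ _) (A1M32 R n m).
by rewrite !adjmxM adjmxK.
Qed.

Lemma M21A2_adj : M21 R n m *m adjmx A2 = adjmx (A2s R m) *m M21 R n m.
Proof.
have := congr1 (@adjmx R _ _) (A2M31 R n m).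
by rewrite !adjmxM adjmxK.
Qed.

Lemma adjA2A1 : adjmx A2 *m A1 = A1 *m adjmx A2.
Proof.
have -> : adjmx A2 = A2 - iC *: (M32 R n m *m M22 R n m) by rewrite -A2_adj subKr.
rewrite mulmxBl mulmxBr A12 -scalemxAl -scalemxAr; congr (_ - _ *: _).
by rewrite mulmxA A1M32 -!mulmxA M22A1.
Qed.

Lemma adjA12 : adjmx A1 *m adjmx A2 = adjmx A2 *m adjmx A1.
Proof. by rewrite -!adjmxM A12. Qed.

Section Point.
Variables mu1 mu2 : C.
Hypotheses (h1 : mu1 != hC) (h2 : mu2 != hC) (h1' : mu1 + hC != 0) (h2' : mu2 + hC != 0).
Let c1 := ((mu1 - hC) / (mu1 + hC)) ^+ n.
Let c2 := ((mu2 - hC) / (mu2 + hC)) ^+ m.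
Let e : 'rV[C]_(n * m) := const_mx 1.

Lemma A1_adj_unit : adjmx A1 - mu1%:M \in unitmx.
Proof. by rewrite adjmx_shift unitmx_adjmx A1_unit conjc_neq_hC h1' orbT. Qed.

Lemma A2_adj_unit : adjmx A2 - mu2%:M \in unitmx.
Proof. by rewrite adjmx_shift unitmx_adjmx A2_unit conjc_neq_hC h2' orbT. Qed.

Lemma M22_ones : const_mx 1 *m M22 R n m = e.
Proof. by apply: trmx_inj; rewrite trmx_mul tr_M22 !trmx_const M32_ones. Qed.

Lemma ones_A1_adj : e *m invmx (adjmx A1 - mu1%:M)
  = const_mx 1 *m invmx (adjmx (A1s R n) - mu1%:M) *m M22 R n m.
Proof.
have u := A1_adj_unit; apply: (can_inj (mulmxK u)); rewrite mulmxKV // -!mulmxA.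
by rewrite -(shift_eq mu1 (esym M22A1_adj)) mulKmx ?A1s_adj_unit // M22_ones.
Qed.

Lemma ones_A2_adj : e *m invmx (adjmx A2 - mu2%:M)
  = const_mx 1 *m invmx (adjmx (A2s R m) - mu2%:M) *m M21 R n m.
Proof.
have u := A2_adj_unit; apply: (can_inj (mulmxK u)); rewrite mulmxKV // -!mulmxA.
by rewrite -(shift_eq mu2 (esym M21A2_adj)) mulKmx ?M21_ones //; exact: A1s_adj_unit.
Qed.

Lemma ones_A1 : e *m invmx (A1 - mu1%:M) = const_mx 1 *m invmx (A1s R n - mu1%:M) *m M22 R n m.
Proof.
have u : A1 - mu1%:M \in unitmx by rewrite A1_unit h1 orbT.
apply: (can_inj (mulmxK u)); rewrite mulmxKV // -!mulmxA.
by rewrite -(shift_eq mu1 (esym (M22A1 R n m))) mulKmx ?A1s_unit ?h1 ?orbT // M22_ones.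
Qed.

Lemma ones_A2 : e *m invmx (A2 - mu2%:M) = const_mx 1 *m invmx (A2s R m - mu2%:M) *m M21 R n m.
Proof.
have u : A2 - mu2%:M \in unitmx by rewrite A2_unit h2 orbT.
apply: (can_inj (mulmxK u)); rewrite mulmxKV // -!mulmxA.
by rewrite -(shift_eq mu2 (esym (M21A2 R n m))) mulKmx ?A2s_unit ?h2 ?orbT // M21_ones.
Qed.

(** The resolvents commute, so each adjoint one can be brought next to the row of ones. There it
    reduces to the small matrix, where [ones_invmx_A1s_adj] replaces it. *)
Lemma ones_adj_adj : e *m invmx (adjmx A1 - mu1%:M) *m invmx (adjmx A2 - mu2%:M)
  = (c1 * c2) *: (e *m invmx (A1 - mu1%:M) *m invmx (A2 - mu2%:M)).
Proof.
have u1 : A1 - mu1%:M \in unitmx by rewrite A1_unit h1 orbT.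
have u2 : A2 - mu2%:M \in unitmx by rewrite A2_unit h2 orbT.
have c : invmx (A1 - mu1%:M) *m invmx (adjmx A2 - mu2%:M)
  = invmx (adjmx A2 - mu2%:M) *m invmx (A1 - mu1%:M).
  apply: (commmx_inv u1 u1); rewrite (commmx_inv A2_adj_unit A2_adj_unit) //.
  exact/shift_comm2/adjA2A1.
have c' : invmx (A1 - mu1%:M) *m invmx (A2 - mu2%:M) = invmx (A2 - mu2%:M) *m invmx (A1 - mu1%:M).
  apply: (commmx_inv u1 u1); rewrite (commmx_inv u2 u2) //.
  exact/shift_comm2/esym/A12.
rewrite ones_A1_adj ones_invmx_A1s_adj // -!scalemxAl -ones_A1 -[e *m _ *m _]mulmxA c mulmxA.
rewrite ones_A2_adj (@ones_invmx_A1s_adj m) // -!scalemxAl -ones_A2 scalerA -[e *m _ *m _]mulmxA -c'.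
by rewrite mulmxA.
Qed.
End Point.
End Adjoint.

(** * Assembly of the blocks of u and its companion *)

Section Main.
Variable R : realType.
Local Notation C := (R[i]).
Local Notation iC := (iC R).
Local Notation hC := (hC R).
Variables n m : nat.
Variable t : int -> int -> C.
Local Notation A1 := (A1 R n m).
Local Notation A2 := (A2 R n m).
Local Notation T := (TBT n m t).
Local Notation U := (flip C (n * m)).
Hypothesis uT : T \in unitmx.

Let x mu1 mu2 := ones R 1 (n * m) *m invmx (adjmx A1 - mu1%:M) *m invmx (adjmx A2 - mu2%:M).
Let y l1 l2 := invmx (A2 - l2%:M) *m invmx (A1 - l1%:M) *m ones R (n * m) 1.
Let v1 mu := ones R 1 n *m invmx (adjmx (A1s R n) - mu%:M).
Let v2 mu := ones R 1 m *m invmx (adjmx (A2s R m) - mu%:M).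
Let w1 l := invmx (A1s R n - l%:M) *m ones R n 1.
Let w2 l := invmx (A2s R m - l%:M) *m ones R m 1.

Lemma u_blocks mu1 mu2 : u n m t mu1 mu2 =
  row_mx (x mu1 mu2 *m (invmx T *m Pi1 n m t) - iC *: row_mx (v2 mu2) 0)
         (x mu1 mu2 *m (invmx T *m Pi2 n m t) - iC *: row_mx (v1 mu1) 0).
Proof. by rewrite /u /Gam mul_mx_row scale_row_mx opp_row_mx add_row_mx. Qed.

Lemma hu_blocks l1 l2 : hu n m t l1 l2 =
  col_mx (hPi1 n m t *m invmx T *m y l1 l2 + iC *: col_mx 0 (w2 l2))
         (hPi2 n m t *m invmx T *m y l1 l2 + iC *: col_mx 0 (w1 l1)).
Proof. by rewrite /hu /hGam 3!mul_col_mx scale_col_mx add_col_mx /y !mulmxA. Qed.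

Lemma mul_P1 p q (a : 'M_(p, _)) b (c : 'M_(_, q)) d :
  row_mx a b *m P1 R n m *m col_mx c d = a *m c.
Proof.
by rewrite /P1 mul_row_block !mulmx0 !addr0 mulmx1 mul_row_col mul0mx addr0.
Qed.

Lemma mul_P2 p q (a : 'M_(p, _)) b (c : 'M_(_, q)) d :
  row_mx a b *m P2 R n m *m col_mx c d = b *m d.
Proof.
by rewrite /P2 mulmxBr mulmxBl mul_P1 mulmx1 mul_row_col addrC addKr.
Qed.

Lemma A_inv_comm l1 l2 : l1 != hC -> l2 != hC ->
  invmx (A1 - l1%:M) *m invmx (A2 - l2%:M) = invmx (A2 - l2%:M) *m invmx (A1 - l1%:M).
Proof.
move=> h1 h2; apply: commmx_inv; rewrite ?A1_unit ?h1 ?orbT //.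
by apply/esym/commmx_inv; rewrite ?A2_unit ?h2 ?orbT //; exact/shift_comm2/esym/A12.
Qed.

Lemma adj_inv_comm mu1 mu2 : mu1 + hC != 0 -> mu2 + hC != 0 ->
  invmx (adjmx A1 - mu1%:M) *m invmx (adjmx A2 - mu2%:M)
  = invmx (adjmx A2 - mu2%:M) *m invmx (adjmx A1 - mu1%:M).
Proof.
move=> h1 h2; apply: commmx_inv; rewrite ?A1_adj_unit ?A2_adj_unit //.
by apply/esym/commmx_inv; rewrite ?A2_adj_unit //; exact/shift_comm2/esym/adjA12.
Qed.

Lemma invmx_A1_ones l : l != hC ->
  invmx (A1 - l%:M) *m ones R (n * m) 1 = M32 R n m *m w1 l.
Proof. by move=> h; rewrite /w1 mulmxA -invmx_A1_M32 // -mulmxA M32_ones. Qed.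

Lemma invmx_A2_ones l : l != hC ->
  invmx (A2 - l%:M) *m ones R (n * m) 1 = M31 R n m *m w2 l.
Proof. by move=> h; rewrite /w2 mulmxA -invmx_A2_M31 // -mulmxA M31_ones. Qed.

Lemma omega_formula l1 l2 mu1 mu2 :
  l1 != hC -> l2 != hC -> mu1 + hC != 0 -> mu2 + hC != 0 ->
  [/\ l1 != mu1 -> omega n m t l1 l2 mu1 mu2
        = iC * (l1 - mu1)^-1 * (u n m t mu1 mu2 *m P1 R n m *m hu n m t l1 l2) ord0 ord0
    & l2 != mu2 -> omega n m t l1 l2 mu1 mu2
        = iC * (l2 - mu2)^-1 * (u n m t mu1 mu2 *m P2 R n m *m hu n m t l1 l2) ord0 ord0].
Proof.
move=> hl1 hl2 hm1 hm2.
have uB1 : A1 - l1%:M \in unitmx by rewrite A1_unit hl1 orbT.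
have uB2 : A2 - l2%:M \in unitmx by rewrite A2_unit hl2 orbT.
have uD1 := A1_adj_unit n m hm1; have uD2 := A2_adj_unit n m hm2.
have eo : omega n m t l1 l2 mu1 mu2 = (x mu1 mu2 *m invmx T *m y l1 l2) 0 0.
  by rewrite /omega /x /y !mulmxA.
rewrite eo u_blocks hu_blocks mul_P1 mul_P2; split=> lmu.
  apply: (omega_half (iCiC R) uT (A1T_adj n m t)) => //.
    (* For p = 1 the resolvents are reordered so that the factor belonging to [A1] can be
       cancelled. *)
    by rewrite /x -mulmxA adj_inv_comm // mulmxA mulmxKV // ones_A2_adj.
  by rewrite /y -A_inv_comm // -mulmxA mulKVmx // invmx_A2_ones.
apply: (omega_half (iCiC R) uT (A2T_adj n m t)) => //.
  by rewrite /x mulmxKV // ones_A1_adj.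
by rewrite /y -mulmxA mulKVmx // invmx_A1_ones.
Qed.

Lemma ones_invmx_ones p k mu : mu != hC ->
  ones R 1 p *m invmx (A1s R p - mu%:M) *m ones R p k
  = (- iC * (1 - ((mu + hC) / (mu - hC)) ^+ p)) *: ones R 1 k.
Proof.
move=> h; have -> : ones R p k = (const_mx 1 : 'cV_p) *m ones R 1 k.
  by apply/matrixP => i j; rewrite [RHS]mxE big_ord1 !mxE mulr1.
by rewrite mulmxA [X in X *m _ = _]mx11_scalar ones_invmx_A1s // mul_scalar_mx.
Qed.

Lemma tr_w p l : l != hC -> (invmx (A1s R p - l%:M) *m ones R p 1)^T *m flip C p
  = ones R 1 p *m invmx (A1s R p - l%:M).
Proof.
move=> h; have uA : A1s R p - l%:M \in unitmx by rewrite A1s_unit h orbT.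
rewrite trmx_mul trmx_const -[in RHS](flip_inv_shift (@flip_A1s R p) uA) !mulmxA.
by rewrite const_flip.
Qed.

Section Point.
Variables mu1 mu2 : C.
Hypotheses (h1 : mu1 != hC) (h2 : mu2 != hC) (h1' : mu1 + hC != 0) (h2' : mu2 + hC != 0).
Let c1 := ((mu1 - hC) / (mu1 + hC)) ^+ n.
Let c2 := ((mu2 - hC) / (mu2 + hC)) ^+ m.
Let uB1 : A1 - mu1%:M \in unitmx. Proof. by rewrite A1_unit h1 orbT. Qed.
Let uB2 : A2 - mu2%:M \in unitmx. Proof. by rewrite A2_unit h2 orbT. Qed.

Let inv_ratio (mu : C) k : mu != hC -> mu + hC != 0 ->
  ((mu - hC) / (mu + hC)) ^+ k * ((mu + hC) / (mu - hC)) ^+ k = 1.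
Proof.
rewrite -subr_eq0 => a b; rewrite -exprMn (_ : _ * _ = 1) ?expr1n //.
by field; rewrite a b.
Qed.

Lemma x_flip_y : x mu1 mu2 = (c1 * c2) *: ((y mu1 mu2)^T *m U).
Proof.
rewrite /x [LHS]ones_adj_adj //; congr (_ *: _); rewrite /y !trmx_mul trmx_const.
rewrite -{1}(flip_inv_shift (@flip_A1 R n m) uB1) -{1}(flip_inv_shift (@flip_A2 R n m) uB2).
by rewrite !mulmxA const_flip -[_ *m U *m U]mulmxA flipK mulmx1.
Qed.

Lemma u_recovery : u n m t mu1 mu2 = (c1 * c2) *: ((hu n m t mu1 mu2)^T
  *m block_mx (Jmx R m *m Umx R m) 0 0 (Jmx R n *m Umx R n)).
Proof.
rewrite u_blocks hu_blocks tr_col_mx !sflipE mul_row_block !mulmx0 addr0 add0r [RHS]scale_row_mx.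
congr row_mx; apply: u_half => //.
- exact: flip_T.
- exact: tr_M21.
- exact: flip_M31.
- exact: compM11E.
- exact: x_flip_y.
(* The last hypothesis of [u_half]. Through [M22 *m M31] the resolvent of [A1] contracts to the
   scalar of [ones_invmx_ones]; its constant part cancels the correction by [w2], and its power is
   inverse to [c1]. *)
- rewrite /w2 tr_w // /v2 [X in _ = _ *: X]ones_invmx_A1s_adj // /x [X in X *m _]ones_adj_adj //.
  rewrite -scalemxAl -[_ *m _ *m M31 R n m]mulmxA invmx_A2_M31 // ones_A1 // !mulmxA.
  rewrite -[_ *m M22 R n m *m M31 R n m]mulmxA M22M31 ones_invmx_ones // -!scalemxAl.
  rewrite !scalerA -scalerDl; congr (_ *: _).
  have e := inv_ratio n h1 h1'; rewrite -/c1 in e.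
  transitivity (iC * c2 * (c1 * ((mu1 + hC) / (mu1 - hC)) ^+ n)); last by rewrite e mulr1.
  by rewrite -/c1 -/c2; move: (_ ^+ n) c1 c2 => q a b; ring.
- exact: flip_T.
- exact: tr_M22.
- exact: flip_M32.
- exact: compM12E.
- exact: x_flip_y.
- rewrite /w1 tr_w // /v1 [X in _ = _ *: X]ones_invmx_A1s_adj // /x [X in X *m _]ones_adj_adj //.
  rewrite -[_ *m invmx (A1 - _) *m _]mulmxA A_inv_comm // mulmxA.
  rewrite -scalemxAl -[_ *m _ *m M32 R n m]mulmxA invmx_A1_M32 // ones_A2 // !mulmxA.
  rewrite -[_ *m M21 R n m *m M32 R n m]mulmxA M21M32 [X in X *m _](ones_invmx_ones m n h2).
  rewrite -!scalemxAl !scalerA -scalerDl; congr (_ *: _).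
  have e := inv_ratio m h2 h2'; rewrite -/c2 in e.
  transitivity (iC * c1 * (c2 * ((mu2 + hC) / (mu2 - hC)) ^+ m)); last by rewrite e mulr1.
  by rewrite -/c1 -/c2; move: (_ ^+ m) c1 c2 => q a b; ring.
Qed.
End Point.
End Main.

Unset Implicit Arguments.

Theorem theorem2p3 (R : realType) (n m : nat) (t : int -> int -> R[i]) :
  (0 < n)%N -> (0 < m)%N ->
  TBT n m t \in unitmx ->
  [/\
   (* g21 is determined by g12 *)
   g21 n m t = - (Umx R n *m Jmx R n *m (g12 n m t)^T *m Jmx R m *m Umx R m),
   (* the formula for omega, p = 1 and p = 2 *)
   (forall l1 l2 mu1 mu2 : R[i],
      A1 R n m - l1%:M \in unitmx -> A2 R n m - l2%:M \in unitmx ->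
      adjmx (A1 R n m) - mu1%:M \in unitmx -> adjmx (A2 R n m) - mu2%:M \in unitmx ->
      [/\ l1 != mu1 ->
            omega n m t l1 l2 mu1 mu2
            = iC R * (l1 - mu1)^-1 * (u n m t mu1 mu2 *m P1 R n m *m hu n m t l1 l2) ord0 ord0
        & l2 != mu2 ->
            omega n m t l1 l2 mu1 mu2
            = iC R * (l2 - mu2)^-1 * (u n m t mu1 mu2 *m P2 R n m *m hu n m t l1 l2) ord0 ord0]),
   (* existence of the polynomial branch theta of sqrt(det G) *)
   (exists th, theta_branch n m t th),
   (* recovery of hat u from G *)
   (forall th, theta_branch n m t th ->
    forall l1 l2 : R[i],
      A1 R n m - l1%:M \in unitmx -> A2 R n m - l2%:M \in unitmx ->
      Gmx n m t l1 l2 \in unitmx ->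
      hu n m t l1 l2 =
        (- iC R * (l1 - halfC R * iC R) ^- n * (l2 - halfC R * iC R) ^- m * eval2 th l1 l2)
          *: (invmx (Gmx n m t l1 l2) *m ecol R n m))
   & (* recovery of u from hat u *)
   (forall mu1 mu2 : R[i],
      A1 R n m - mu1%:M \in unitmx -> A2 R n m - mu2%:M \in unitmx ->
      adjmx (A1 R n m) - mu1%:M \in unitmx -> adjmx (A2 R n m) - mu2%:M \in unitmx ->
      u n m t mu1 mu2 =
        (((mu1 - halfC R * iC R) / (mu1 + halfC R * iC R)) ^+ n
         * ((mu2 - halfC R * iC R) / (mu2 + halfC R * iC R)) ^+ m)
          *: ((hu n m t mu1 mu2)^T
              *m block_mx (Jmx R m *m Umx R m) 0 0 (Jmx R n *m Umx R n)))].
Proof.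
move=> n0 m0 uT.
(* For nonempty matrices the invertibility hypotheses mean that the spectral parameters avoid i/2,
   and -i/2 for the adjoints. *)
have nm0 : (n * m == 0)%N = false by rewrite muln_eq0 !eqn0Ngt n0 m0.
have unit1 l : A1 R n m - l%:M \in unitmx -> l != hC R by rewrite A1_unit nm0.
have unit2 l : A2 R n m - l%:M \in unitmx -> l != hC R by rewrite A2_unit nm0.
have unit1' l : adjmx (A1 R n m) - l%:M \in unitmx -> l + hC R != 0.
  by rewrite adjmx_shift unitmx_adjmx A1_unit nm0 /= conjc_neq_hC.
have unit2' l : adjmx (A2 R n m) - l%:M \in unitmx -> l + hC R != 0.
  by rewrite adjmx_shift unitmx_adjmx A2_unit nm0 /= conjc_neq_hC.
split.
- exact: g21_from_g12.
- by move=> l1 l2 mu1 mu2 /unit1 ? /unit2 ? /unit1' ? /unit2' ?; exact: omega_formula.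
- by exists (theta0 n m t); exact: theta0_branch.
(* By uniqueness the given branch is [theta0], whose explicit value cancels the scalar in
   [Gmx_hu]. *)
- move=> th /(theta_branch_unique n0 m0 uT) -> l1 l2 /unit1 h1 /unit2 h2 uG.
  apply: (can_inj (mulKmx uG)); rewrite -scalemxAr mulKVmx // Gmx_hu // theta0_eval //.
  congr (_ *: _); rewrite -/(hC R).
  have p1 : (l1 - hC R) ^+ n != 0 by rewrite expf_neq0 // subr_eq0.
  have p2 : (l2 - hC R) ^+ m != 0 by rewrite expf_neq0 // subr_eq0.
  move: (_ ^+ n) (_ ^+ m) p1 p2 => a b p1 p2; field.
  by rewrite p1 p2.
- by move=> mu1 mu2 /unit1 ? /unit2 ? /unit1' ? /unit2' ?; exact: u_recovery.
Qed.
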